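(* Let $\Sigma\subseteq\mathbb{C}$ be a nonempty compact set, let $L$ be a bounded band operator on $\ell^2(\mathbb{Z})$ with $LS=SL$, and let $\gamma\in\mathbb{Z}$. For $u\in\Sigma^{\mathbb{Z}}$ put $H(u):=L+S^\gamma M_u$. Let $b,b_1,b_2,\ldots\in\Sigma^{\mathbb{Z}}$, and put $A:=H(b)$ and $A_m:=H(b_m)$ for $m\in\mathbb{N}$. Suppose that \[ \forall N\in\mathbb{N}\ \exists m_0\in\mathbb{N}\ \forall m\ge m_0:\quad \mathcal{W}_N(b_m)=\mathcal{W}_N(b). \] Then, for all $\lambda\in\mathbb{C}$ and all $\varepsilon>0$, as $m\to\infty$, \[ \|(A_m-\lambda)^{-1}\|\to\|(A-\lambda)^{-1}\|\qquad\text{and}\qquad \sigma_\varepsilon(A_m)\to\sigma_\varepsilon(A)\ \text{in the Hausdorff distance.} \] If, in addition, $A_m$ (for all $m$) and $A$ are normal, then also $\sigma(A_m)\to\sigma(A)$ in the Hausdorff distance.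
   Context: $S$ is the shift on $\ell^2(\mathbb{Z})$, $(Sx)_n=x_{n-1}$, and $M_u$ is the multiplication operator $(M_ux)_n=u_nx_n$. A band operator on $\ell^2(\mathbb{Z})$ is an operator of the form $\sum_{k=-w}^{w}M_{a^{(k)}}S^k$ with $a^{(k)}\in\ell^\infty(\mathbb{Z})$ (equivalently, a matrix with finitely many nonzero bounded diagonals). For $u\in\Sigma^{\mathbb{Z}}$ and $N\in\mathbb{N}$, $\mathcal{W}_N(u)$ denotes the set of all subwords of length $N$ of $u$, i.e. the set of all words $(u(k),u(k+1),\dots,u(k+N-1))\in\Sigma^N$ with $k\in\mathbb{Z}$. For a bounded operator $T$, $\sigma(T)$ is its spectrum and, for $\varepsilon>0$, $\sigma_\varepsilon(T):=\{\lambda\in\mathbb{C}:\|(T-\lambda)^{-1}\|>1/\varepsilon\}$, with the convention $\|B^{-1}\|:=\infty$ if $B$ is not invertible (so $\|(A-\lambda)^{-1}\|$ may equal $\infty$). *)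

(* Defs.v *)
From HB Require Import structures.
From mathcomp Require Import all_boot all_order all_algebra.
From mathcomp Require Import all_classical all_reals all_analysis.
From mathcomp Require Import complex.
Set Implicit Arguments. Unset Strict Implicit. Unset Printing Implicit Defensive.
Import Order.TTheory GRing.Theory Num.Theory.
Import numFieldTopology.Exports numFieldNormedType.Exports.
Local Open Scope ring_scope.
Local Open Scope classical_set_scope.

Section Defs.
Variable R : realType.
Local Notation C := (R[i]).

Definition seqZ := int -> C.
(* operators are maps on all sequences (band operators are defined there) *)
Definition opZ := seqZ -> seqZ.

Definition cabs (z : C) : R := ComplexField.Normc.normc z.

Definition psum2 (x : seqZ) (N : nat) : R :=
  \sum_(i < N.*2.+1) cabs (x (i%:Z - N%:Z)) ^+ 2.

Definition l2 (x : seqZ) : Prop := exists M : R, forall N, psum2 x N <= M.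

Definition l2norm (x : seqZ) : R := Num.sqrt (sup [set psum2 x N | N in [set: nat]]).

Definition ipsum (x y : seqZ) (N : nat) : C :=
  \sum_(i < N.*2.+1) x (i%:Z - N%:Z) * (y (i%:Z - N%:Z))^*.

Definition shiftp (g : int) (x : seqZ) : seqZ := fun n => x (n - g).
Definition shiftZ : opZ := shiftp 1.
Definition multop (u : seqZ) (x : seqZ) : seqZ := fun n => u n * x n.

Definition band (w : nat) (a : int -> seqZ) : opZ := fun x n =>
  \sum_(i < w.*2.+1) a (i%:Z - w%:Z) n * x (n - (i%:Z - w%:Z)).

Definition Hop (L : opZ) (g : int) (u : seqZ) : opZ :=
  fun x n => L x n + shiftp g (multop u x) n.

Definition subI (T : opZ) (lam : C) : opZ := fun x n => T x n - lam * x n.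

Definition invertible (T : opZ) : Prop :=
  [/\ (forall x, l2 x -> l2 (T x)),
      (forall x y, l2 x -> l2 y -> T x = T y -> x = y),
      (forall y, l2 y -> exists x, l2 x /\ T x = y) &
      (exists c : R, forall x, l2 x -> l2norm x <= c * l2norm (T x))].

(* ||T^{-1}|| (= +oo if T is not invertible):
   sup_{y <> 0} ||T^{-1} y|| / ||y|| = sup_{x in l2, x <> 0} ||x|| / ||T x|| *)
Definition invnorm (T : opZ) : \bar R :=
  if `[< invertible T >] then
    ereal_sup [set (l2norm x / l2norm (T x))%:E | x in [set x | l2 x /\ l2norm x != 0]]
  else +oo%E.

Definition spectrum (T : opZ) : set C := [set lam | ~ invertible (subI T lam)].

Definition pseudospectrum (T : opZ) (eps : R) : set C :=
  [set lam | (eps^-1%:E < invnorm (subI T lam))%E].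

Definition normal_op (T : opZ) : Prop :=
  exists Ts : opZ,
    [/\ (forall x, l2 x -> l2 (Ts x)),
        (forall x y, l2 x -> l2 y ->
           (fun N => cabs (ipsum (T x) y N - ipsum x (Ts y) N)) @ \oo --> (0 : R)) &
        (forall x, l2 x -> T (Ts x) = Ts (T x))].

Definition cdist (z : C) (Y : set C) : \bar R :=
  ereal_inf [set (cabs (z - y))%:E | y in Y].

Definition hausdorff (X Y : set C) : \bar R :=
  maxe (ereal_sup [set cdist x Y | x in X]) (ereal_sup [set cdist y X | y in Y]).

Definition subwords (N : nat) (u : seqZ) : set (seq C) :=
  [set mkseq (fun i => u (k + i%:Z)) N | k in [set: int]].

End Defs.

(* C as a numFieldType, to equip it with its (norm) topology *)
Definition Cnum (R : realType) : numFieldType := R[i].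

(* Main.v *)
(** The operators [A - lambda] are compared through their lower norms, i.e. the
    largest [c] with [c |x| <= |T x|]. The resolvent norm of [T] is at most [1/c]
    iff both [T] and its adjoint have lower norm at least [c]. For a band
    operator the lower norm is attained, up to [O(1/sqrt N)] uniformly in
    [lambda], on vectors supported in an interval of length [N], and on those
    the lower norm of [H(u) - lambda] depends on [u] only through its subwords
    of length [N]. Hence the lower norms of [A_m - lambda] converge to those of
    [A - lambda] uniformly in [lambda], which is the convergence of the resolvent
    norms.

    For the pseudospectra one needs that the lower norm of [T - z] has no positive
    local minimum in [z]. If [w = T x] and [z] runs through the fourth roots of
    [r^4], the parallelogram law gives the mean of [|(T - z)(T + z) x|^2] as
    [|T w|^2 + r^4 |x|^2] and the mean of [|(T + z) x|^2] as [|w|^2 + r^2 |x|^2],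
    so some [T - z] has lower norm smaller than [|T w| / |w|] by a controlled
    amount. If moreover [|T x|^2 <= |T^2 x| |x|], as for normal operators, the
    same computation with [r] half the lower norm [c] shrinks the lower norm by
    the factor 19/20; iterating yields a point of the spectrum within [40 c]. *)

Require Import Defs.
From HB Require Import structures.
From mathcomp Require Import all_boot all_order all_algebra.
From mathcomp Require Import all_classical all_reals all_analysis.
From mathcomp Require Import complex ring lra zify.
Import Order.TTheory GRing.Theory Num.Theory.
Import numFieldTopology.Exports numFieldNormedType.Exports.
Local Open Scope ring_scope.
Local Open Scope classical_set_scope.

Local Notation Re := complex.Re.
Local Notation Im := complex.Im.

Set Implicit Arguments.
Unset Strict Implicit.
Unset Printing Implicit Defensive.

(** * The modulus and square-summable families *)

Section Modulus.
Variable R : realType.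
Implicit Types z : R[i].

Lemma cabs_ge0 z : 0 <= cabs z.
Proof. by case: z => a b; rewrite /cabs /= sqrtr_ge0. Qed.

Lemma cabsD z1 z2 : cabs (z1 + z2) <= cabs z1 + cabs z2.
Proof. exact: le_normcD. Qed.

Lemma cabsM z1 z2 : cabs (z1 * z2) = cabs z1 * cabs z2.
Proof. exact: ComplexField.Normc.normcM. Qed.

Lemma cabsN z : cabs (- z) = cabs z.
Proof. exact: normcN. Qed.

Lemma cabs0 : cabs (0 : R[i]) = 0.
Proof. exact: ComplexField.Normc.normc0. Qed.

Lemma cabs0_eq z : cabs z = 0 -> z = 0.
Proof. exact: ComplexField.Normc.eq0_normc. Qed.

Lemma cabsB z1 z2 : cabs (z1 - z2) = cabs (z2 - z1).
Proof. by rewrite -cabsN opprB. Qed.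

Lemma sqr_cabs z : cabs z ^+ 2 = Re z ^+ 2 + Im z ^+ 2.
Proof.
by case: z => a b; rewrite /cabs /= sqr_sqrtr// addr_ge0// sqr_ge0.
Qed.

Lemma cabs_conj z : cabs z^* = cabs z.
Proof. by case: z => a b; rewrite /cabs /= sqrrN. Qed.

Lemma cabsR (r : R) : cabs r%:C%C = `|r|.
Proof. by rewrite /cabs /= expr0n /= addr0 sqrtr_sqr. Qed.

Lemma cabs_sum (J : finType) (F : J -> R[i]) :
  cabs (\sum_j F j) <= \sum_j cabs (F j).
Proof.
elim/big_rec2: _ => [|j a b _ H]; first by rewrite cabs0.
by rewrite (le_trans (cabsD _ _))// lerD2l.
Qed.

Lemma Re_ge_cabs z : `|Re z| <= cabs z.
Proof.
rewrite -(ler_pXn2r (n := 2))// ?nnegrE ?cabs_ge0 ?normr_ge0//.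
by rewrite sqr_cabs real_normK ?num_real// lerDl sqr_ge0.
Qed.

Lemma Im_ge_cabs z : `|Im z| <= cabs z.
Proof.
rewrite -(ler_pXn2r (n := 2))// ?nnegrE ?cabs_ge0 ?normr_ge0//.
by rewrite sqr_cabs real_normK ?num_real// lerDr sqr_ge0.
Qed.

Lemma cabs_le_ReIm z : cabs z <= `|Re z| + `|Im z|.
Proof.
rewrite -(ler_pXn2r (n := 2))// ?nnegrE ?cabs_ge0 ?addr_ge0 ?normr_ge0//.
rewrite sqr_cabs sqrrD !real_normK ?num_real// -addrA lerD2l lerDr.
by rewrite mulrn_wge0// mulr_ge0.
Qed.

End Modulus.

Section SquareSummable.
Variables (R : realType) (I : choiceType).
Implicit Types f g : I -> R[i].

(** Valued in the extended reals and over any index type: it is total, reindexing is free, and it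
    serves [int] as well as, for the localization, [int * int]. *)
Definition sqn f : \bar R := \esum_(i in [set: I]) (cabs (f i) ^+ 2)%:E.
Definition sqsum f : Prop := (sqn f < +oo)%E.
Definition nrm f : R := Num.sqrt (fine (sqn f)).

Lemma sqn_ge0 f : (0 <= sqn f)%E.
Proof. by apply: esum_ge0 => i _; rewrite lee_fin sqr_ge0. Qed.

Lemma nrm_ge0 f : 0 <= nrm f.
Proof. exact: sqrtr_ge0. Qed.

Lemma sqnE f : sqsum f -> sqn f = (nrm f ^+ 2)%:E.
Proof.
move=> ff; rewrite /nrm sqr_sqrtr ?fine_ge0 ?sqn_ge0// fineK//.
by rewrite ge0_fin_numE// sqn_ge0.
Qed.

Lemma nrm_sqrE f (r : R) : 0 <= r -> sqn f = (r ^+ 2)%:E -> nrm f = r.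
Proof. by move=> r0 e; rewrite /nrm e /= sqrtr_sqr ger0_norm. Qed.

Lemma le_nrm_sqn f (r : R) : 0 <= r -> (sqn f <= (r ^+ 2)%:E)%E ->
  sqsum f /\ nrm f <= r.
Proof.
move=> r0 e; have ff : sqsum f by rewrite /sqsum (le_lt_trans e)// ltry.
split => //; move: e; rewrite sqnE// lee_fin ler_pXn2r// nnegrE//.
exact: nrm_ge0.
Qed.

Lemma esum_le_scale (c : R) (a a' : I -> R) : 0 <= c ->
  (forall i, 0 <= a i) -> (forall i, a' i <= c * a i) ->
  (\esum_(i in [set: I]) (a' i)%:E <= c%:E * \esum_(i in [set: I]) (a i)%:E)%E.
Proof.
move=> c0 a0 ha; apply: ge_ereal_sup => _ [X [finX _] <-].
apply: (@le_trans _ _ (c%:E * \sum_(i \in X) (a i)%:E)%E).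
  rewrite ge0_mule_fsumr; last by move=> i; rewrite lee_fin.
  by apply: lee_fsum => // i _; rewrite -EFinM lee_fin.
apply: lee_pmul => //.
- by apply: fsume_ge0 => i _; rewrite lee_fin.
- by apply: esum_ge; exists X => //; split.
Qed.

Lemma sqn_le_scale (c : R) f g : 0 <= c ->
  (forall i, cabs (g i) <= c * cabs (f i)) -> sqsum f ->
  sqsum g /\ nrm g <= c * nrm f.
Proof.
move=> c0 h ff; apply: le_nrm_sqn; first by rewrite mulr_ge0// nrm_ge0.
rewrite exprMn EFinM -sqnE//; apply: esum_le_scale.
- exact: sqr_ge0.
- by move=> i; exact: sqr_ge0.
- by move=> i; rewrite -exprMn ler_pXn2r// nnegrE ?cabs_ge0// mulr_ge0// cabs_ge0.
Qed.

Lemma sqsumZ (c : R[i]) f : sqsum f -> sqsum (fun i => c * f i).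
Proof.
move=> /(@sqn_le_scale (cabs c) f (fun i => c * f i))[]//; rewrite ?cabs_ge0//.
by move=> i; rewrite cabsM.
Qed.

Lemma nrmZ (c : R[i]) f : sqsum f -> nrm (fun i => c * f i) = cabs c * nrm f.
Proof.
move=> ff; apply/le_anti/andP; split.
  by have /(@sqn_le_scale (cabs c) f (fun i => c * f i))[]// := ff;
    rewrite ?cabs_ge0// => i; rewrite cabsM.
have [->|c0] := eqVneq c 0; first by rewrite cabs0 mul0r nrm_ge0.
have cc : 0 < cabs c.
  by rewrite lt_neqAle cabs_ge0 andbT eq_sym; apply: contra_neq c0 => /cabs0_eq.
rewrite -ler_pdivlMl//.
apply: (@sqn_le_scale (cabs c)^-1 (fun i => c * f i) f _ _ _).2.
- by rewrite invr_ge0 cabs_ge0.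
- by move=> i; rewrite cabsM mulKf// gt_eqF.
- exact: sqsumZ.
Qed.

(* The triangle inequality is read off, by optimising over [t], from the
   pointwise bound [|a + b|^2 <= (1 + t) |a|^2 + (1 + 1/t) |b|^2]. *)
Lemma nrmD_subproof f g : sqsum f -> sqsum g ->
  sqsum (fun i => f i + g i) /\ nrm (fun i => f i + g i) <= nrm f + nrm g.
Proof.
move=> ff fg.
have key (e : R) : 0 < e -> sqsum (fun i => f i + g i) /\
    nrm (fun i => f i + g i) <= nrm f + nrm g + e *+ 2.
  move=> e0; apply: le_nrm_sqn.
    by rewrite !addr_ge0 ?nrm_ge0// ltW.
  (* The slack [e] keeps [F] and [G] positive, so the optimal [t = G / F] exists even if a norm
     vanishes; for it the bound equals [(F + G) ^+ 2]. *)
  set F := nrm f + e; set G := nrm g + e.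
  have F0 : 0 < F by rewrite ltr_wpDl// nrm_ge0.
  have G0 : 0 < G by rewrite ltr_wpDl// nrm_ge0.
  pose t := G / F; have t0 : 0 < t by rewrite divr_gt0.
  have -> : nrm f + nrm g + e *+ 2 = F + G by rewrite /F /G; ring.
  apply: (@le_trans _ _ ((1 + t)%:E * sqn f + (1 + t^-1)%:E * sqn g)%E).
    apply: (@le_trans _ _ (\esum_(i in [set: I])
        (((1 + t) * cabs (f i) ^+ 2)%:E + ((1 + t^-1) * cabs (g i) ^+ 2)%:E))%E).
      apply: le_esum => i _; rewrite -EFinD lee_fin.
      apply: (@le_trans _ _ ((cabs (f i) + cabs (g i)) ^+ 2)).
        by rewrite ler_pXn2r// ?nnegrE ?addr_ge0 ?cabs_ge0// cabsD.
      set a := cabs _; set b := cabs _.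
      rewrite -subr_ge0.
      have -> : (1 + t) * a ^+ 2 + (1 + t^-1) * b ^+ 2 - (a + b) ^+ 2 =
          t^-1 * (t * a - b) ^+ 2 by field; rewrite gt_eqF.
      by rewrite mulr_ge0 ?sqr_ge0// invr_ge0 ltW.
    rewrite esumD; last 2 first.
    - by move=> i _; rewrite lee_fin mulr_ge0 ?sqr_ge0// addr_ge0// ltW.
    - by move=> i _; rewrite lee_fin mulr_ge0 ?sqr_ge0// addr_ge0// ltW// invr_gt0.
    apply: leeD; apply: esum_le_scale => // [|i]; rewrite ?sqr_ge0//.
      by rewrite addr_ge0// ltW.
    by rewrite addr_ge0// ltW// invr_gt0.
  rewrite !sqnE// -!EFinM -EFinD lee_fin.
  apply: (@le_trans _ _ ((1 + t) * F ^+ 2 + (1 + t^-1) * G ^+ 2)).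
    apply: lerD; (rewrite ler_wpM2l//; last rewrite ler_pXn2r ?nnegrE ?nrm_ge0 ?ltW//).
    - by rewrite addr_ge0// ltW.
    - by rewrite ltrDl.
    - by rewrite addr_ge0// ltW// invr_gt0.
    - by rewrite ltrDl.
  rewrite le_eqVlt; apply/orP; left; apply/eqP; rewrite /t; field.
  by rewrite !gt_eqF.
split; first exact: (key 1 ltr01).1.
apply/ler_addgt0Pr => e e0; have e20 : 0 < e / 2 by rewrite divr_gt0.
have [_ /le_trans] := key _ e20; apply; rewrite lerD2l le_eqVlt.
by apply/orP; left; apply/eqP; field.
Qed.

Lemma sqsumD f g : sqsum f -> sqsum g -> sqsum (fun i => f i + g i).
Proof. by move=> ff fg; have [] := nrmD_subproof ff fg. Qed.

Lemma nrmD f g : sqsum f -> sqsum g ->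
  nrm (fun i => f i + g i) <= nrm f + nrm g.
Proof. by move=> ff fg; have [] := nrmD_subproof ff fg. Qed.

Lemma sqsumN f : sqsum f -> sqsum (fun i => - f i).
Proof.
move=> /(sqsumZ (-1)); congr sqsum; apply/funext => i; exact: mulN1r.
Qed.

Lemma nrmN f : nrm (fun i => - f i) = nrm f.
Proof.
by rewrite /nrm /sqn; congr (Num.sqrt (fine _)); apply: eq_esum => i _; rewrite cabsN.
Qed.

Lemma sqsumB f g : sqsum f -> sqsum g -> sqsum (fun i => f i - g i).
Proof. by move=> ff fg; exact: sqsumD ff (sqsumN fg). Qed.

Lemma nrmB f g : sqsum f -> sqsum g ->
  nrm (fun i => f i - g i) <= nrm f + nrm g.
Proof. by move=> ff fg; rewrite -(nrmN g); exact: nrmD ff (sqsumN fg). Qed.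

Lemma nrm_subC f g : nrm (fun i => f i - g i) = nrm (fun i => g i - f i).
Proof. by rewrite -nrmN; congr nrm; apply/funext => i; rewrite opprB. Qed.

Lemma nrm_dist f g : sqsum f -> sqsum g ->
  nrm f - nrm g <= nrm (fun i => f i - g i).
Proof.
move=> ff fg; rewrite lerBlDr (le_trans _ (nrmD (sqsumB ff fg) fg))//.
by rewrite [X in _ <= nrm X](_ : _ = f)//; apply/funext => i; rewrite subrK.
Qed.

Lemma parallelogram f g : sqsum f -> sqsum g ->
  nrm (fun i => f i + g i) ^+ 2 + nrm (fun i => f i - g i) ^+ 2 =
  nrm f ^+ 2 *+ 2 + nrm g ^+ 2 *+ 2.
Proof.
move=> ff fg; apply: EFin_inj; rewrite !EFinD.
rewrite -!sqnE//; try by [exact: sqsumD|exact: sqsumB].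
rewrite /sqn -!esumD; try by move=> i _; rewrite ?adde_ge0// ?lee_fin// ?sqr_ge0.
apply: eq_esum => i _; rewrite -!EFinD; congr EFin.
rewrite !sqr_cabs; case: (f i) => a b; case: (g i) => c d /=; ring.
Qed.

Lemma cabs_le_nrm f i : sqsum f -> cabs (f i) <= nrm f.
Proof.
move=> ff; rewrite -(ler_pXn2r (n := 2))// ?nnegrE ?cabs_ge0 ?nrm_ge0//.
rewrite -lee_fin -sqnE//; apply: esum_ge; exists [set i].
  by split => //; exact: finite_set1.
by rewrite fsbig_set1.
Qed.

Lemma nrm0_eq f i : sqsum f -> nrm f = 0 -> f i = 0.
Proof.
move=> ff f0; apply: cabs0_eq; apply/le_anti/andP.
by rewrite cabs_ge0 -{1}f0; split => //; exact: cabs_le_nrm.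
Qed.

Lemma sqn0 : sqn (fun=> 0) = 0%E.
Proof. by rewrite /sqn esum1// => i _; rewrite cabs0 expr0n. Qed.

Lemma sqsum0 : sqsum (fun=> 0).
Proof. by rewrite /sqsum sqn0 ltry. Qed.

Lemma nrm0 : nrm (fun=> 0) = 0.
Proof. by rewrite /nrm sqn0 sqrtr0. Qed.

Lemma sqsum_sum (J : Type) (r : seq J) (F : J -> I -> R[i]) :
  (forall j, sqsum (F j)) -> sqsum (fun i => \sum_(j <- r) F j i) /\
  nrm (fun i => \sum_(j <- r) F j i) <= \sum_(j <- r) nrm (F j).
Proof.
move=> hF; elim: r => [|j r [ih1 ih2]].
  rewrite (_ : (fun i => _) = fun=> 0); last by apply/funext => i; rewrite big_nil.
  by rewrite nrm0 big_nil; split => //; exact: sqsum0.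
rewrite (_ : (fun i => _) = fun i => F j i + \sum_(j <- r) F j i); last first.
  by apply/funext => i; rewrite big_cons.
split; first exact: sqsumD.
by rewrite big_cons (le_trans (nrmD _ _))// lerD2l.
Qed.

End SquareSummable.

Lemma sqn_reindex (R : realType) (I J : choiceType) (e : I -> J) (f : J -> R[i]) :
  bijective e -> sqn (fun i => f (e i)) = sqn f.
Proof.
move=> be; rewrite /sqn (@reindex_esum R I J setT setT e)//.
by rewrite setTT_bijective.
Qed.

(** * Sequences indexed by the integers *)

Section SequencesOnZ.
Variable R : realType.
Implicit Types (x y v : int -> R[i]).

Let window (N : nat) : set int := (fun i : nat => i%:Z - N%:Z) @` `I_N.*2.+1.

Let windowE N (n : int) : window N n <-> (`|n| <= N)%N.
Proof.
split; first by move=> [i /= hi <-]; lia.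
by move=> hn; exists (absz (n + N%:Z)); rewrite /=; lia.
Qed.

Let finite_window N : finite_set (window N).
Proof. by apply: finite_image; exact: finite_II. Qed.

Let psum2_fsbig x N :
  (psum2 x N)%:E = (\sum_(n \in window N) (cabs (x n) ^+ 2)%:E)%E.
Proof.
rewrite /psum2 -sumEFin.
rewrite (fsbig_ord _ _ (fun i : nat => (cabs (x (i%:Z - N%:Z)) ^+ 2)%:E)).
by rewrite fsbig_image// => i j _ _ /= h; lia.
Qed.

Lemma psum2_le_sqn x N : ((psum2 x N)%:E <= sqn x)%E.
Proof. by rewrite psum2_fsbig; apply: esum_ge; exists (window N) => //; split. Qed.

Let fsum_le_psum2 x (X : set int) : finite_set X ->
  exists N, (\sum_(n \in X) (cabs (x n) ^+ 2)%:E <= (psum2 x N)%:E)%E.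
Proof.
move=> finX; have [F XF] := finite_fsetP.1 finX.
exists (\max_(n <- finmap.enum_fset F) absz n)%N; rewrite psum2_fsbig.
apply: lee_fsum_nneg_subset => //.
  move=> n; rewrite !inE XF /= => nF; apply/windowE.
  by apply: (@leq_bigmax_seq _ _ xpredT absz).
by move=> n _; rewrite lee_fin sqr_ge0.
Qed.

Lemma psum2_nondecreasing x : nondecreasing_seq (psum2 x).
Proof.
move=> M N MN; rewrite -lee_fin !psum2_fsbig; apply: lee_fsum_nneg_subset => //.
  by move=> n; rewrite !inE => /windowE h; apply/windowE; exact: leq_trans MN.
by move=> n _; rewrite lee_fin sqr_ge0.
Qed.

Lemma sqn_le_psum2 x (M : R) : (forall N, psum2 x N <= M) -> (sqn x <= M%:E)%E.
Proof.
move=> h; apply: ge_ereal_sup => _ [X [finX _] <-].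
by have [N /le_trans] := fsum_le_psum2 x finX; apply; rewrite lee_fin.
Qed.

(** Every finite set of indices lies in some window [[-N, N]], so bounded symmetric partial sums
    amount to unconditional summability. *)
Lemma l2E x : l2 x <-> sqsum x.
Proof.
split; first by case=> M /sqn_le_psum2/le_lt_trans; apply; exact: ltry.
move=> hx; exists (nrm x ^+ 2) => N.
by rewrite -lee_fin -sqnE//; exact: psum2_le_sqn.
Qed.

Lemma psum2_sup x : sqsum x -> sup (range (psum2 x)) = nrm x ^+ 2.
Proof.
move=> hx; have ub : ubound (range (psum2 x)) (nrm x ^+ 2).
  by move=> _ [N _ <-]; rewrite -lee_fin -sqnE//; exact: psum2_le_sqn.
apply/le_anti/andP; split.
  by apply: ge_sup => //; exists (psum2 x 0), 0.
rewrite -lee_fin -sqnE//; apply: sqn_le_psum2 => N.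
by apply: ub_le_sup; [exists (nrm x ^+ 2)|exists N].
Qed.

Lemma l2normE x : sqsum x -> l2norm x = nrm x.
Proof.
by move=> hx; rewrite /l2norm psum2_sup// sqrtr_sqr ger0_norm// nrm_ge0.
Qed.

Lemma psum2_cvg x : sqsum x -> psum2 x @ \oo --> nrm x ^+ 2.
Proof.
move=> hx; rewrite -psum2_sup//; apply: nondecreasing_cvgn.
  exact: psum2_nondecreasing.
exists (nrm x ^+ 2) => _ [N _ <-].
by rewrite -lee_fin -sqnE//; exact: psum2_le_sqn.
Qed.

(** The real part of the inner product, by polarization; built from norms, it is visibly invariant
    under reindexing. *)
Definition rip x y : R :=
  (nrm (fun n => x n + y n) ^+ 2 - nrm (fun n => x n - y n) ^+ 2) / 4.

Definition rdot (z1 z2 : R[i]) : R := Re z1 * Re z2 + Im z1 * Im z2.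

Lemma Re_mul_conj (z1 z2 : R[i]) : Re (z1 * z2^*) = rdot z1 z2.
Proof. by case: z1 z2 => a b [c d]; rewrite /rdot /=; ring. Qed.

Definition rpsum x y N : R :=
  \sum_(i < N.*2.+1) rdot (x (i%:Z - N%:Z)) (y (i%:Z - N%:Z)).

Lemma Re_ipsum x y N : Re (ipsum x y N) = rpsum x y N.
Proof.
rewrite /ipsum (raddf_sum (@complex.Re R)) /rpsum.
by apply: eq_bigr => i _; rewrite -Re_mul_conj.
Qed.

Lemma rpsum_cvg x y : sqsum x -> sqsum y -> rpsum x y @ \oo --> rip x y.
Proof.
move=> hx hy.
rewrite (_ : rpsum x y = fun N =>
   (psum2 (fun n => x n + y n) N - psum2 (fun n => x n - y n) N) / 4).
  exact: (cvgMr_tmp (cvgB (psum2_cvg (sqsumD hx hy)) (psum2_cvg (sqsumB hx hy)))).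
apply/funext => N; rewrite /psum2 -sumrB mulr_suml; apply: eq_bigr => i _.
by rewrite !sqr_cabs /rdot; case: (x _) => a b; case: (y _) => c d /=; field.
Qed.

(** Algebraic identities for [rip] are checked termwise on partial sums and then passed to the
    limit. *)
Lemma rip_unique x y (l : R) : sqsum x -> sqsum y ->
  rpsum x y @ \oo --> l -> rip x y = l.
Proof. by move=> hx hy; apply: cvg_unique (rpsum_cvg hx hy). Qed.

Lemma ripC x y : sqsum x -> sqsum y -> rip x y = rip y x.
Proof.
move=> hx hy; rewrite /rip (nrm_subC x y); congr ((nrm _ ^+ 2 - _) / 4).
by apply/funext => n; rewrite addrC.
Qed.

Lemma ripDl x v y : sqsum x -> sqsum v -> sqsum y ->
  rip (fun n => x n + v n) y = rip x y + rip v y.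
Proof.
move=> hx hv hy; apply: rip_unique => //; first exact: sqsumD.
rewrite (_ : rpsum _ y = fun N => rpsum x y N + rpsum v y N).
  by apply: cvgD; exact: rpsum_cvg.
apply/funext => N; rewrite /rpsum -big_split; apply: eq_bigr => i _ /=.
by rewrite /rdot; case: (x _) => a b; case: (v _) => c d /=; ring.
Qed.

Lemma ripDr x v y : sqsum x -> sqsum v -> sqsum y ->
  rip y (fun n => x n + v n) = rip y x + rip y v.
Proof.
move=> hx hv hy.
by rewrite ripC ?ripDl ?(ripC hx hy) ?(ripC hv hy)//; exact: sqsumD.
Qed.

Lemma ripMl (a : int -> R[i]) x y : sqsum (fun n => a n * x n) -> sqsum x ->
  sqsum y -> sqsum (fun n => (a n)^* * y n) ->
  rip (fun n => a n * x n) y = rip x (fun n => (a n)^* * y n).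
Proof.
move=> hax hx hy hay; apply: rip_unique => //.
rewrite (_ : rpsum _ y = rpsum x (fun n => (a n)^* * y n)); first exact: rpsum_cvg.
apply/funext => N; apply: eq_bigr => i _; rewrite /rdot.
by case: (a _) => p q; case: (x _) => r s; case: (y _) => t u /=; ring.
Qed.

Lemma rip_reindex x y (e : int -> int) : bijective e ->
  rip (fun n => x (e n)) (fun n => y (e n)) = rip x y.
Proof.
move=> be; rewrite /rip /nrm.
rewrite (sqn_reindex (fun n => x n + y n) be).
by rewrite (sqn_reindex (fun n => x n - y n) be).
Qed.

Lemma ripZl (t : R) x y : sqsum x -> sqsum y ->
  rip (fun n => t%:C%C * x n) y = t * rip x y.
Proof.
move=> hx hy; apply: rip_unique => //; first exact: sqsumZ.
rewrite (_ : rpsum _ y = fun N => t * rpsum x y N).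
  by exact: (cvgMl_tmp (rpsum_cvg hx hy)).
apply/funext => N; rewrite /rpsum mulr_sumr; apply: eq_bigr => i _.
by rewrite /rdot; case: (x _) => a b /=; ring.
Qed.

Lemma ripxx x : sqsum x -> rip x x = nrm x ^+ 2.
Proof.
move=> hx; rewrite /rip (_ : (fun n => x n + x n) = fun n => 2%:R%:C%C * x n).
  rewrite (_ : (fun n => x n - x n) = fun=> 0).
    by rewrite nrmZ// nrm0 cabsR ger0_norm//; field.
  by apply/funext => n; rewrite subrr.
by apply/funext => n; case: (x n) => a b; congr Complex => /=; ring.
Qed.

(** Cauchy-Schwarz from polarization: the two triangle inequalities bound the numerator by [(|x| +
    |y|)^2 - (|x| - |y|)^2 = 4 |x| |y|]. *)
Lemma rip_le x y : sqsum x -> sqsum y -> rip x y <= nrm x * nrm y.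
Proof.
move=> hx hy; rewrite /rip ler_pdivrMr//.
have h1 := nrmD hx hy; have h2 := nrm_dist hx hy.
have h3 := nrm_dist hy hx; rewrite nrm_subC in h3.
set s := nrm (fun n => x n + y n) in h1 *.
set d := nrm (fun n => x n - y n) in h2 h3 *.
have s0 : 0 <= s := nrm_ge0 _.
have d0 : 0 <= d := nrm_ge0 _.
have x0 : 0 <= nrm x := nrm_ge0 _.
have y0 : 0 <= nrm y := nrm_ge0 _.
have e1 : s ^+ 2 <= (nrm x + nrm y) ^+ 2.
  by rewrite ler_pXn2r// nnegrE addr_ge0.
have e2 : (nrm x - nrm y) ^+ 2 <= d ^+ 2.
  rewrite -real_normK ?num_real// ler_pXn2r ?nnegrE// ler_norml.
  by apply/andP; split; lra.
nra.
Qed.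

Lemma nrm_sqrB x y (t : R) : sqsum x -> sqsum y ->
  nrm (fun n => x n - t%:C%C * y n) ^+ 2 =
  nrm x ^+ 2 - t * rip x y *+ 2 + t ^+ 2 * nrm y ^+ 2.
Proof.
move=> hx hy; have hty := sqsumZ (- t)%:C%C hy.
rewrite (_ : (fun n => _) = fun n => x n + (- t)%:C%C * y n); last first.
  by apply/funext => n; rewrite rmorphN mulNr.
rewrite -ripxx; last exact: sqsumD.
rewrite ripDl ?ripDr ?ripZl//; try exact: sqsumD.
rewrite (ripC hx hty) (ripC hy hty) !ripZl// (ripC hy hx) ripxx// ripxx//.
ring.
Qed.

End SequencesOnZ.

(** * Limits of sequences with geometrically decreasing increments *)

Section GeometricLimit.
Variable R : realType.

(** With [e n] the tail of the geometric series, the intervals [[u n - e n, u n + e n]] are nested;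
    the limit is the supremum of their left endpoints. *)
Let geometric_cvgR (u : R^nat) (M q : R) : 0 <= M -> 0 <= q -> q < 1 ->
  (forall n, `|u n.+1 - u n| <= M * q ^+ n) ->
  exists l, forall n, `|u n - l| <= M / (1 - q) * q ^+ n.
Proof.
move=> M0 q0 q1 hu; have q1' : 0 < 1 - q by rewrite subr_gt0.
pose e n := M / (1 - q) * q ^+ n.
have he n : M * q ^+ n = e n - e n.+1 by rewrite /e exprS; field; rewrite gt_eqF.
have e0 n : 0 <= e n by rewrite /e mulr_ge0 ?exprn_ge0// divr_ge0// ltW.
have hd n k : `|u (n + k)%N - u n| <= e n - e (n + k)%N.
  elim: k => [|k ih]; first by rewrite addn0 !subrr normr0.
  rewrite addnS (_ : u _ - u n = (u (n + k).+1 - u (n + k)%N) + (u (n + k)%N - u n));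
    last by ring.
  by rewrite (le_trans (ler_normD _ _))//; have := hu (n + k)%N; rewrite he; lra.
pose lo n := u n - e n.
have lo_ub n m : lo m <= u n + e n.
  have [nm|/ltnW mn] := leqP n m.
    have := hd n (m - n)%N; rewrite subnKC// => /ler_normlP[_ h].
    by have := e0 m; rewrite /lo; lra.
  have := hd m (n - m)%N; rewrite subnKC// => /ler_normlP[h _].
  by have := e0 n; rewrite /lo; lra.
exists (sup (range lo)) => n.
have h1 : lo n <= sup (range lo).
  by apply: ub_le_sup; [exists (u 0 + e 0) => _ [m _ <-]|exists n].
have h2 : sup (range lo) <= u n + e n.
  by apply: ge_sup; [exists (lo 0), 0|move=> _ [m _ <-]].
by rewrite -/(e n) ler_norml; apply/andP; split; move: h1 h2; rewrite /lo; lra.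
Qed.

(** Real and imaginary parts converge separately, hence the factor 2. *)
Lemma geometric_cvg (u : nat -> R[i]) (M q : R) : 0 <= M -> 0 <= q -> q < 1 ->
  (forall n, cabs (u n.+1 - u n) <= M * q ^+ n) ->
  exists l, forall n, cabs (u n - l) <= 2 * M / (1 - q) * q ^+ n.
Proof.
move=> M0 q0 q1 hu.
have [|a ha] := @geometric_cvgR (fun n => Re (u n)) M q M0 q0 q1.
  by move=> n; rewrite (le_trans _ (hu n))// -raddfB Re_ge_cabs.
have [|b hb] := @geometric_cvgR (fun n => Im (u n)) M q M0 q0 q1.
  by move=> n; rewrite (le_trans _ (hu n))// -raddfB Im_ge_cabs.
exists (a +i* b)%C => n; rewrite (le_trans (cabs_le_ReIm _))//.
move: (ha n) (hb n); case: (u n) => p s /= h1 h2.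
by rewrite -!mulrA mulrDl mul1r !mulrA lerD.
Qed.

Lemma geometric_lt (q C e : R) : 0 <= q -> q < 1 -> 0 < e ->
  exists n, C * q ^+ n < e.
Proof.
move=> q0 q1 e0.
have : (fun n => C * q ^+ n) @ \oo --> (C * 0 : R).
  by apply: cvgMl_tmp; apply: cvg_expr; rewrite ger0_norm.
rewrite mulr0 => /cvgrPdist_lt /(_ _ e0)[n _ /(_ n (leqnn n))].
by rewrite sub0r normrN => /(le_lt_trans (ler_norm _)) => ?; exists n.
Qed.

End GeometricLimit.

(** * Bounded operators with an adjoint *)

Section AdjointPairs.
Variable R : realType.
Local Notation seqC := (int -> R[i]).
Implicit Types (T Ts : opZ R) (x y u : seqC) (K c : R) (z : R[i]).

(* The sup-norm bound is what lets an operator commute with the pointwise limits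
   in [adjoint_surjective], which replaces a completeness theorem for l^2. *)
Record bounded_op K T : Prop := BoundedOp {
  bounded_ge0 : 0 <= K;
  bounded_lin : forall z x y,
    T (fun n => x n + z * y n) = (fun n => T x n + z * T y n);
  bounded_l2 : forall x, sqsum x -> sqsum (T x) /\ nrm (T x) <= K * nrm x;
  bounded_sup : forall x s, (forall n, cabs (x n) <= s) ->
    forall n, cabs (T x n) <= K * s }.

(** Equality of real parts suffices: by linearity, replacing [x] by ['i * x] gives the imaginary
    parts. *)
Record adjoint_pair K T Ts : Prop := AdjointPair {
  pair_op : bounded_op K T;
  pair_adj : bounded_op K Ts;
  pair_rip : forall x y, sqsum x -> sqsum y -> rip (T x) y = rip x (Ts y) }.

Lemma bounded_opB K T x y : bounded_op K T ->
  T (fun n => x n - y n) = fun n => T x n - T y n.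
Proof.
move=> hT; have := bounded_lin hT (-1) x y.
rewrite (_ : (fun n => _) = fun n => x n - y n); last first.
  by apply/funext => n; rewrite mulN1r.
by move=> ->; apply/funext => n; rewrite mulN1r.
Qed.

Lemma bounded_op_sub K T z : bounded_op K T -> bounded_op (K + cabs z) (subI T z).
Proof.
move=> hT; split.
- by rewrite addr_ge0 ?cabs_ge0// (bounded_ge0 hT).
- move=> w x y; rewrite /subI (bounded_lin hT); apply/funext => n; ring.
- move=> x hx; have [h1 h2] := bounded_l2 hT hx; split.
    exact/sqsumB/sqsumZ.
  by rewrite (le_trans (nrmB _ _))//; [exact: sqsumZ|rewrite nrmZ// mulrDl lerD2r].
- move=> x s hs n; rewrite /subI (le_trans (cabsD _ _))// cabsN cabsM mulrDl lerD//.
    exact: (bounded_sup hT hs).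
  by rewrite ler_wpM2l// cabs_ge0.
Qed.

Lemma adjoint_pair_sub K T Ts z : adjoint_pair K T Ts ->
  adjoint_pair (K + cabs z) (subI T z) (subI Ts z^*).
Proof.
case=> hT hTs h; split; first exact: bounded_op_sub.
  by rewrite -(cabs_conj z); exact: bounded_op_sub.
move=> x y hx hy; have [hTx _] := bounded_l2 hT hx.
have [hTy _] := bounded_l2 hTs hy.
rewrite /subI.
rewrite (_ : (fun n => T x n - z * x n) = fun n => T x n + (- z) * x n); last first.
  by apply/funext => n; rewrite mulNr.
rewrite (_ : (fun n => Ts y n - z^* * y n) = fun n => Ts y n + (- z)^* * y n);
  last by apply/funext => n; rewrite rmorphN mulNr.
rewrite ripDl ?ripDr ?h//; try exact: sqsumZ.
by congr (_ + _); apply: (ripMl (a := fun=> - z)) => //; exact: sqsumZ.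
Qed.

Lemma subI_sub T z w : subI (subI T z) w = subI T (z + w).
Proof. by apply/funext => x; apply/funext => n; rewrite /subI; ring. Qed.

(** Negative [c] are allowed and make the condition void, so thresholds [c - delta] need no sign
    check. *)
Definition bdd_below T c := forall x, sqsum x -> c * nrm x <= nrm (T x).

(** For [c > 0] this says that the inverse exists with norm at most [1/c], see [invnorm_le]; the
    bound on [Ts] encodes surjectivity of [T]. *)
Definition bdd_below2 T Ts c := bdd_below T c /\ bdd_below Ts c.

Lemma bdd_below_le T c c' : c' <= c -> bdd_below T c -> bdd_below T c'.
Proof.
by move=> h hT x hx; rewrite (le_trans _ (hT x hx))// ler_wpM2r// nrm_ge0.
Qed.

Lemma bdd_below2_le T Ts c c' : c' <= c -> bdd_below2 T Ts c -> bdd_below2 T Ts c'.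
Proof. by move=> h [h1 h2]; split; exact: (bdd_below_le h). Qed.

Lemma bdd_below_sub K T z c : bounded_op K T ->
  bdd_below T c -> bdd_below (subI T z) (c - cabs z).
Proof.
move=> hT h x hx; have [hTx _] := bounded_l2 hT hx.
rewrite mulrBl -nrmZ// (le_trans (lerB (h x hx) (lexx _)))//.
by apply: nrm_dist => //; exact: sqsumZ.
Qed.

Lemma bdd_below2_sub K T Ts z c : adjoint_pair K T Ts ->
  bdd_below2 T Ts c -> bdd_below2 (subI T z) (subI Ts z^*) (c - cabs z).
Proof.
move=> hT [h1 h2]; split; first exact: (bdd_below_sub z (pair_op hT) h1).
by rewrite -(cabs_conj z); exact: (bdd_below_sub _ (pair_adj hT) h2).
Qed.

Definition l2_surjective T := forall y, sqsum y -> exists2 x, sqsum x & T x = y.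

(** Writing [u = T x], one has [|u|^2 = <x, Ts u> <= |x| |Ts u|], while [c |x| <= |u|]. *)
Lemma bdd_below_adjoint K T Ts c : adjoint_pair K T Ts -> 0 <= c ->
  l2_surjective T -> bdd_below T c -> bdd_below Ts c.
Proof.
move=> hT c0 sT lT u hu; have [x hx xu] := sT u hu.
have [hTu _] := bounded_l2 (pair_adj hT) hu.
have h1 : nrm u ^+ 2 <= nrm x * nrm (Ts u).
  by rewrite -ripxx// -{1}xu (pair_rip hT)// rip_le.
have h2 := lT x hx; rewrite xu in h2.
have [->|u0] := eqVneq (nrm u) 0; first by rewrite mulr0 nrm_ge0.
have u1 : 0 < nrm u by rewrite lt_neqAle eq_sym u0 nrm_ge0.
rewrite -(ler_pM2l u1); have : c * nrm u ^+ 2 <= c * (nrm x * nrm (Ts u)).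
  by rewrite ler_wpM2l.
have : c * nrm x * nrm (Ts u) <= nrm u * nrm (Ts u) by rewrite ler_wpM2r// nrm_ge0.
by move: (nrm u) (nrm x) (nrm _) => a b d; nra.
Qed.

(** * Surjectivity from a lower bound on the adjoint *)

Section Neumann.
Variables (K c : R) (T Ts : opZ R).
Hypotheses (hT : adjoint_pair K T Ts) (c0 : 0 < c) (hTs : bdd_below Ts c).

Let B u := T (Ts u).
(** [K1] is positive and majorizes both [K] and [c]. From [<u, B u> = |Ts u|^2 >= c^2 |u|^2] and
    [|B u| <= K1^2 |u|], the factor [1 - 2 t c^2 + t^2 K1^4] bounds [|u - t B u|^2 / |u|^2]; [t] is
    its minimizer and [q^2] its minimum. *)
Let K1 := K + c.
Let t := c ^+ 2 / K1 ^+ 4.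
Let q := Num.sqrt (1 - c ^+ 4 / K1 ^+ 4).

Let K0 : 0 <= K. Proof. exact: bounded_ge0 (pair_op hT). Qed.
Let K1_gt0 : 0 < K1. Proof. by rewrite /K1; move: K0 c0; lra. Qed.
Let t_gt0 : 0 < t. Proof. by rewrite /t divr_gt0// exprn_gt0. Qed.

Let frac_lt1 : 0 <= 1 - c ^+ 4 / K1 ^+ 4 < 1.
Proof.
have h : 0 < c ^+ 4 / K1 ^+ 4 by rewrite divr_gt0// exprn_gt0.
have h' : c ^+ 4 / K1 ^+ 4 <= 1.
  have c0' := ltW c0; have K10 := ltW K1_gt0.
  by rewrite ler_pdivrMr ?exprn_gt0// mul1r ler_pXn2r// /K1 lerDr K0.
by apply/andP; split; lra.
Qed.

Let q_ge0 : 0 <= q. Proof. exact: sqrtr_ge0. Qed.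
Let q_lt1 : q < 1.
Proof. by rewrite -[ltRHS]sqrtr1 ltr_sqrt//; have /andP[] := frac_lt1. Qed.

Let Bsq u : sqsum u -> sqsum (B u).
Proof.
move=> hu; have [h _] := bounded_l2 (pair_adj hT) hu.
by have [] := bounded_l2 (pair_op hT) h.
Qed.

Let B_sub u v : B (fun n => u n - v n) = fun n => B u n - B v n.
Proof.
by rewrite /B (bounded_opB _ _ (pair_adj hT)) (bounded_opB _ _ (pair_op hT)).
Qed.

Let contraction u : sqsum u -> nrm (fun n => u n - t%:C%C * B u n) <= q * nrm u.
Proof.
move=> hu; have [h hn] := bounded_l2 (pair_adj hT) hu.
have [hB hBn] := bounded_l2 (pair_op hT) h.
rewrite -(ler_pXn2r (n := 2)) ?nnegrE ?mulr_ge0 ?nrm_ge0//.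
have q2 : q ^+ 2 = 1 - c ^+ 4 / K1 ^+ 4 by apply: sqr_sqrtr; have /andP[] := frac_lt1.
rewrite nrm_sqrB// [(q * _) ^+ 2]exprMn q2.
have -> : rip u (B u) = nrm (Ts u) ^+ 2.
  by rewrite ripC// (pair_rip hT)// ripxx.
have hB2 : nrm (B u) ^+ 2 <= K1 ^+ 4 * nrm u ^+ 2.
  rewrite (_ : K1 ^+ 4 * _ = (K1 * (K1 * nrm u)) ^+ 2); last by ring.
  have K10 := ltW K1_gt0.
  rewrite ler_pXn2r// ?nnegrE ?nrm_ge0 ?mulr_ge0 ?mulr_ge0 ?nrm_ge0//.
  have KK : K <= K1 by rewrite /K1 lerDl ltW.
  rewrite (le_trans hBn)// ler_pM// ?nrm_ge0//.
  by rewrite (le_trans hn)// ler_wpM2r// nrm_ge0.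
have hA : c ^+ 2 * nrm u ^+ 2 <= nrm (Ts u) ^+ 2.
  have c0' := ltW c0.
  by rewrite -exprMn ler_pXn2r ?nnegrE ?nrm_ge0 ?mulr_ge0 ?nrm_ge0// hTs.
have t2 : t ^+ 2 * nrm (B u) ^+ 2 <= t * c ^+ 2 * nrm u ^+ 2.
  have -> : t * c ^+ 2 * nrm u ^+ 2 = t ^+ 2 * (K1 ^+ 4 * nrm u ^+ 2).
    by rewrite /t; field; rewrite gt_eqF.
  by rewrite ler_wpM2l// sqr_ge0.
have t1 : t * (c ^+ 2 * nrm u ^+ 2) <= t * nrm (Ts u) ^+ 2.
  by rewrite ler_wpM2l// ltW.
have -> : (1 - c ^+ 4 / K1 ^+ 4) * nrm u ^+ 2 =
    nrm u ^+ 2 - t * c ^+ 2 * nrm u ^+ 2.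
  by rewrite /t; field; rewrite gt_eqF.
lra.
Qed.

(* With [t] small, [1 - t T Ts] is a strict contraction, so the Richardson
   iteration for [T (Ts u) = y] converges geometrically. *)
Lemma adjoint_surjective : l2_surjective T.
Proof.
move=> y hy.
pose X := fix X n : seqC :=
  if n is m.+1 then fun k => X m k + t%:C%C * (y k - B (X m) k) else fun=> 0.
have Xsq n : sqsum (X n).
  elim: n => [|n ih]; first exact: sqsum0.
  by apply: sqsumD => //; apply/sqsumZ/sqsumB => //; exact: Bsq.
pose d n : seqC := fun k => X n.+1 k - X n k.
have dE n k : d n k = t%:C%C * (y k - B (X n) k) by rewrite /d /= addrC addKr.
have dsq n : sqsum (d n) by exact: sqsumB.
have dS n : d n.+1 = fun k => d n k - t%:C%C * B (d n) k.
  have -> : B (d n) = fun k => B (X n.+1) k - B (X n) k by exact: B_sub.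
  by apply/funext => k; rewrite !dE; ring.
pose M := nrm (d 0%N); have M0 : 0 <= M := nrm_ge0 _.
have dn n : nrm (d n) <= M * q ^+ n.
  elim: n => [|n ih]; first by rewrite expr0 mulr1.
  rewrite dS (le_trans (contraction (dsq n)))// exprS mulrCA.
  by rewrite ler_wpM2l.
have Xd n : X n.+1 = fun k => X n k + d n k.
  by apply/funext => k; rewrite /d addrC subrK.
have q1 : 0 < 1 - q by rewrite subr_gt0.
have Xn n : nrm (X n) <= M / (1 - q).
  suff : nrm (X n) <= M / (1 - q) * (1 - q ^+ n).
    move=> /le_trans; apply; rewrite -[leRHS]mulr1 ler_wpM2l ?(divr_ge0, ltW q1)//.
    by rewrite lerBlDr lerDl exprn_ge0.
  elim: n => [|n ih]; first by rewrite expr0 subrr mulr0 nrm0.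
  rewrite Xd (le_trans (nrmD _ _))// (le_trans (lerD ih (dn n)))//.
  rewrite le_eqVlt; apply/orP; left; apply/eqP; rewrite exprS; field.
  by rewrite gt_eqF.
have [x hx] : {x : seqC | forall k n,
    cabs (X n k - x k) <= 2 * M / (1 - q) * q ^+ n}.
  suff h k : exists l, forall n, cabs (X n k - l) <= 2 * M / (1 - q) * q ^+ n.
    by exists (fun k => projT1 (cid (h k))) => k; exact: projT2 (cid (h k)).
  apply: (geometric_cvg (u := X^~ k)) => // n.
  by rewrite (le_trans _ (dn n))//; exact: (cabs_le_nrm k (dsq n)).
set C := 2 * M / (1 - q) in hx.
(* For each window [[-N, N]] an iterate is taken within [1/(2N+1)] of [x] in every coordinate; by
   [|x|^2 <= 2 |X n|^2 + 2 |X n - x|^2] the errors then add up to at most 2. *)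
have xsq : sqsum x.
  apply/l2E; exists ((M / (1 - q)) ^+ 2 *+ 2 + 2) => N.
  have [n hn] : exists n, C * q ^+ n < (N.*2.+1%:R)^-1.
    by apply: geometric_lt => //; rewrite invr_gt0 ltr0n.
  apply: (@le_trans _ _ (psum2 (X n) N *+ 2 +
      \sum_(i < N.*2.+1) (2 * (N.*2.+1%:R)^-1))).
    rewrite /psum2 -sumrMnl -big_split /=; apply: ler_sum => i _.
    set k := (i%:Z - N%:Z).
    have h := hx k n.
    apply: (@le_trans _ _ (cabs (X n k) ^+ 2 *+ 2 + cabs (X n k - x k) ^+ 2 *+ 2)).
      rewrite !sqr_cabs; case: (X n k) => a b; case: (x k) => a' b' /=.
      by have := sqr_ge0 (2 * a - a'); have := sqr_ge0 (2 * b - b'); lra.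
    rewrite lerD2l [leRHS]mulr_natl lerMn2r/=.
    have N1 : (N.*2.+1%:R)^-1 <= (1 : R) by rewrite invf_le1 ?ltr0n// ler1n.
    have := cabs_ge0 (X n k - x k); move: (cabs _) (_^-1) hn N1 h => e g.
    by move: (C * _) => w; nra.
  rewrite sumr_const card_ord (_ : 2 / _ *+ _ = 2); last first.
    by rewrite -[LHS]mulr_natr divfK// pnatr_eq0.
  rewrite lerD2r.
  rewrite lerMn2r /= (@le_trans _ _ (nrm (X n) ^+ 2))//.
    by rewrite -lee_fin -sqnE//; exact: psum2_le_sqn.
  by rewrite ler_pXn2r ?nnegrE ?nrm_ge0 ?(divr_ge0, ltW q1).
exists (Ts x); first exact: (bounded_l2 (pair_adj hT) xsq).1.
apply/funext => k; apply/eqP; rewrite -subr_eq0; apply/eqP/cabs0_eq.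
apply/le_anti/andP; split; last exact: cabs_ge0.
rewrite leNgt; apply/negP => e0.
(* The residual at [k] splits into [y - B (X n)], which is [d n / t], and [B (X n) - B x],
   controlled by applying the sup-norm bound twice. *)
have [n] := geometric_lt (M / t + K * (K * C)) q_ge0 q_lt1 e0.
apply/negP; rewrite -leNgt.
have -> : T (Ts x) k - y k = - (y k - B (X n) k) - (B (X n) k - B x k).
  by rewrite /B; ring.
rewrite (le_trans (cabsD _ _))// !cabsN mulrDl lerD//.
  rewrite mulrAC ler_pdivlMr// mulrC.
  have := dE n k => /(congr1 (@cabs R)); rewrite cabsM cabsR gtr0_norm// => <-.
  by rewrite (le_trans (cabs_le_nrm k (dsq n))).
have h1 := bounded_sup (pair_adj hT) (x := fun k => X n k - x k) (hx^~ n).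
have := bounded_sup (pair_op hT) h1 k.
by rewrite -/(B _) B_sub !mulrA.
Qed.

End Neumann.

End AdjointPairs.

(** * Lower norms, invertibility and the spectrum *)

Section LowerNorms.
Variable R : realType.
Implicit Types (T Ts : opZ R) (x y u : int -> R[i]) (K c : R) (z : R[i]).

Lemma subI0 T : subI T 0 = T.
Proof. by apply/funext => x; apply/funext => n; rewrite /subI mul0r subr0. Qed.

Lemma bdd_below2_invertible K T Ts c : adjoint_pair K T Ts -> 0 < c ->
  bdd_below2 T Ts c -> invertible T.
Proof.
move=> hT c0 [h1 h2]; have hK := pair_op hT; split.
- by move=> x /l2E hx; apply/l2E; exact: (bounded_l2 hK hx).1.
- move=> x y /l2E hx /l2E hy e; have hxy := sqsumB hx hy.
  have := h1 _ hxy; rewrite (bounded_opB _ _ hK) e.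
  rewrite (_ : (fun n => T y n - T y n) = fun=> 0); last first.
    by apply/funext => n; rewrite subrr.
  rewrite nrm0 pmulr_rle0// => n0.
  apply/funext => n; apply/eqP; rewrite -subr_eq0; apply/eqP.
  by apply: (nrm0_eq n hxy); apply/le_anti; rewrite n0 nrm_ge0.
- move=> y /l2E hy; have [x hx <-] := adjoint_surjective hT c0 h2 hy.
  by exists x; split => //; exact/l2E.
- exists c^-1 => x /l2E hx; have [hTx _] := bounded_l2 hK hx.
  by rewrite !l2normE// ler_pdivlMl// h1.
Qed.

Lemma invertible_surjective T : invertible T -> l2_surjective T.
Proof.
case=> _ _ h _ y /l2E hy; have [x [/l2E hx <-]] := h y hy.
by exists x.
Qed.

Lemma invertible_bdd_below2 K T Ts : adjoint_pair K T Ts -> invertible T ->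
  exists2 c, 0 < c & bdd_below2 T Ts c.
Proof.
move=> hT iT; have [_ _ _ [c hc]] := iT.
(* The constant in [invertible] carries no sign; the maximum with 1 makes it positive. *)
pose d := Num.max c 1; have d0 : 0 < d by rewrite lt_max ltr01 orbT.
have lT : bdd_below T d^-1.
  move=> x hx; have [hTx _] := bounded_l2 (pair_op hT) hx.
  rewrite ler_pdivrMl//; have /l2E/hc := hx; rewrite !l2normE//.
  by move=> /le_trans; apply; rewrite ler_wpM2r ?nrm_ge0// le_max lexx.
exists d^-1; first by rewrite invr_gt0.
split => //; apply: (bdd_below_adjoint hT) lT; first by rewrite invr_ge0 ltW.
exact: invertible_surjective.
Qed.

(** Translates resolvent norms into lower norms. The quotients only see [T], and invertibility
    carries the bound over to [Ts]; conversely the two lower bounds give invertibility. *)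
Lemma invnorm_le K T Ts c : adjoint_pair K T Ts -> 0 < c ->
  (invnorm T <= (c^-1)%:E)%E <-> bdd_below2 T Ts c.
Proof.
move=> hT c0; have hK := pair_op hT; rewrite /invnorm; split.
  case: asboolP => // iT; have [e e0 [le _]] := invertible_bdd_below2 hT iT.
  move=> h; have lT : bdd_below T c.
    move=> x hx; have [hTx _] := bounded_l2 hK hx.
    have [->|x0] := eqVneq (nrm x) 0; first by rewrite mulr0 nrm_ge0.
    have x1 : 0 < nrm x by rewrite lt_neqAle eq_sym x0 nrm_ge0.
    have Tx0 : 0 < nrm (T x) by rewrite (lt_le_trans _ (le x hx))// mulr_gt0.
    have : ((nrm x / nrm (T x))%:E <= (c^-1)%:E)%E.
      apply: le_trans h; apply: ereal_sup_ubound; exists x => /=.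
        by split; [exact/l2E|rewrite l2normE].
      by rewrite !l2normE.
    by rewrite lee_fin ler_pdivrMr// ler_pdivlMl.
  split => //; apply: (bdd_below_adjoint hT (ltW c0)) lT.
  exact: invertible_surjective.
move=> h; have iT := bdd_below2_invertible hT c0 h.
case: asboolP => // _; apply: ge_ereal_sup => _ [x [/= /l2E hx x0] <-].
have [hTx _] := bounded_l2 hK hx; rewrite !l2normE// in x0 *.
have x1 : 0 < nrm x by rewrite lt_neqAle eq_sym x0 nrm_ge0.
have Tx0 : 0 < nrm (T x) by rewrite (lt_le_trans _ (h.1 x hx))// mulr_gt0.
by rewrite lee_fin ler_pdivrMr// ler_pdivlMl// h.1.
Qed.

Lemma not_bdd_below T c : ~ bdd_below T c ->
  exists2 x, sqsum x & nrm (T x) < c * nrm x.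
Proof.
move=> h; apply: contrapT => h'; apply: h => x hx; rewrite leNgt; apply/negP => h.
by apply: h'; exists x.
Qed.

Lemma bdd_below_adjoint_not K T Ts c : adjoint_pair K T Ts -> 0 <= c ->
  invertible T -> ~ bdd_below2 T Ts c -> ~ bdd_below T c.
Proof.
move=> hT c0 iT h lT; apply: h; split => //.
by apply: (bdd_below_adjoint hT c0) lT; exact: invertible_surjective.
Qed.

(* Averaging over the fourth roots of unity: by the parallelogram law the means
   of [|(T - z)(T + z) x|^2] and of [|(T + z) x|^2] over [z = r, -r, ir, -ir]
   are the two sides of the hypothesis. *)
Lemma fourth_roots_average K T x (r rho : R) : bounded_op K T -> 0 <= r ->
  sqsum x ->
  nrm (T (T x)) ^+ 2 + r ^+ 4 * nrm x ^+ 2 <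
    rho * (nrm (T x) ^+ 2 + r ^+ 2 * nrm x ^+ 2) ->
  exists z y, [/\ cabs z = r, sqsum y &
    nrm (subI T z y) ^+ 2 < rho * nrm y ^+ 2].
Proof.
move=> hT r0 hx hyp; have [hTx _] := bounded_l2 hT hx.
have [hTTx _] := bounded_l2 hT hTx.
apply: contrapT => hno.
have hz z : cabs z = r -> rho * nrm (fun n => T x n + z * x n) ^+ 2 <=
    nrm (fun n => T (T x) n - z ^+ 2 * x n) ^+ 2.
  move=> zr; rewrite leNgt; apply/negP => h; apply: hno.
  (* The witness is [(T + z) x], since [(T - z) (T + z) x = T (T x) - z^2 x]. *)
  exists z, (fun n => T x n + z * x n); split => //.
    exact/sqsumD/sqsumZ.
  congr (_ < _): h; congr (nrm _ ^+ 2); apply/funext => n.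
  by rewrite /subI (bounded_lin hT); ring.
pose w : R[i] := r%:C%C.
have wr : cabs w = r by rewrite cabsR ger0_norm.
have ir : cabs ('i%C * w) = r.
  by rewrite cabsM wr /cabs /= expr0n expr1n add0r sqrtr1 mul1r.
have i2 : ('i%C * w) ^+ 2 = - w ^+ 2 by rewrite exprMn sqr_i mulN1r.
have nw (v : R[i]) y : sqsum y ->
    nrm (fun n => v * y n) ^+ 2 = cabs v ^+ 2 * nrm y ^+ 2.
  by move=> hy; rewrite nrmZ// exprMn.
have P v : sqsum (fun n : int => v * x n) := sqsumZ v hx.
have := parallelogram hTx (P w); have := parallelogram hTx (P ('i%C * w)).
have := parallelogram hTTx (P (w ^+ 2)).
have h1 := hz _ wr; have := hz (- w); rewrite cabsN => /(_ wr) h2.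
have h3 := hz _ ir; have := hz (- ('i%C * w)); rewrite cabsN => /(_ ir) h4.
rewrite (nw w x hx) (nw ('i%C * w) x hx) (nw (w ^+ 2) x hx) wr ir.
have cw : cabs (w ^+ 2) = r ^+ 2 by rewrite expr2 cabsM wr.
rewrite cw.
rewrite sqrrN in h2; rewrite sqrrN i2 in h4; rewrite i2 in h3.
have e1 v y : (fun n : int => y n + - v * x n) = (fun n => y n - v * x n).
  by apply/funext => n; rewrite mulNr.
have e2 v y : (fun n : int => y n - - v * x n) = (fun n => y n + v * x n).
  by apply/funext => n; rewrite mulNr opprK.
rewrite e1 in h2; rewrite e2 in h3; rewrite e1 e2 in h4.
move: h1 h2 h3 h4 hyp.
set a1 := nrm _ ^+ 2; set a2 := nrm _ ^+ 2; set a3 := nrm _ ^+ 2.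
set a4 := nrm _ ^+ 2; set a5 := nrm _ ^+ 2; set a6 := nrm _ ^+ 2.
rewrite -exprM /=.
set X := nrm x ^+ 2; set Y := nrm (T x) ^+ 2; set Z := nrm (T (T x)) ^+ 2.
move=> h1 h2 h3 h4 hyp E1 E2 E3.
(* The squares of the four roots are [w ^+ 2] and [- w ^+ 2], each taken twice, hence the repetition
   of [a2] and [a5]. *)
have : rho * (a1 + a3 + a4 + a6) <= (a2 + a2 + a5 + a5) by lra.
have -> : a1 + a3 + a4 + a6 = (Y + r ^+ 2 * X) *+ 4 by lra.
have -> : a2 + a2 + a5 + a5 = (Z + r ^+ 4 * X) *+ 4 by lra.
move: (Z + _) (Y + _) hyp => A B; rewrite mulrnAr; lra.
Qed.

Lemma sqr_lt_not_bdd_below T y (rho : R) : 0 <= rho -> sqsum y ->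
  nrm (T y) ^+ 2 < rho ^+ 2 * nrm y ^+ 2 -> ~ bdd_below T rho.
Proof.
move=> r0 hy h lT; have := lT _ hy; rewrite leNgt => /negP; apply.
by rewrite -(ltr_pXn2r (n := 2)) ?nnegrE ?mulr_ge0 ?nrm_ge0// exprMn.
Qed.

(* No positive local minimum of the lower norm of [T - z]; quantitatively, so
   that no compactness argument is needed for the pseudospectra. *)
Lemma lower_norm_decreases K (eps eta : R) : 0 < K -> 0 < eps -> 0 < eta ->
  exists2 delta, 0 < delta < eps & forall T Ts, adjoint_pair K T Ts ->
    ~ bdd_below2 T Ts (eps + delta) -> exists2 z, cabs z <= eta &
    ~ bdd_below2 (subI T z) (subI Ts z^*) (eps - delta).
Proof.
move=> K0 e0 eta0.
(* The averaging must absorb the excess [((eps + d)^2 - (eps - d)^2) |w|^2 = 4 eps d |w|^2] into the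
   gain [r^2 ((eps - d)^2 - r^2) |x|^2]. With [r <= eps / 4] and [d <= eps / 2] the gain is at least
   [r^2 eps^2 |x|^2 / 16]; the second bound on [d], with [|w| <= K |x|], keeps the excess below
   this. *)
pose r := Num.min eta (eps / 4).
have r0 : 0 < r by rewrite lt_min eta0 divr_gt0.
have re : r <= eps / 4 by rewrite ge_min lexx orbT.
pose d := Num.min (eps / 2) (r ^+ 2 * eps / (64 * K ^+ 2)).
have d0 : 0 < d.
  by rewrite lt_min !divr_gt0 ?mulr_gt0 ?exprn_gt0.
have d1 : d <= eps / 2 by rewrite ge_min lexx.
have d2 : d * (64 * K ^+ 2) <= r ^+ 2 * eps.
  by rewrite -ler_pdivlMr ?mulr_gt0 ?exprn_gt0// ge_min lexx orbT.
exists d; first by apply/andP; split; move: e0 d0 d1; lra.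
move=> T Ts hT hn.
(* If the bound already fails at [eps - d], then [z = 0] works. Otherwise [T] is invertible, so the
   near-minimizer [w] has a preimage [x] to average over. *)
have [h|] := pselect (bdd_below2 T Ts (eps - d)); last first.
  by move=> h; exists 0; [rewrite cabs0 ltW|rewrite conjC0 !subI0].
have ed : 0 < eps - d by move: e0 d1; lra.
have ed' : 0 <= eps + d by rewrite addr_ge0 ?ltW.
have iT := bdd_below2_invertible hT ed h.
have /not_bdd_below[w hw hTw] : ~ bdd_below T (eps + d).
  exact: (bdd_below_adjoint_not hT ed' iT hn).
have [x hx xw] := invertible_surjective iT hw.
have [_ wK] := bounded_l2 (pair_op hT) hx; rewrite xw in wK.
have [z [y [zr hy hzy]]] : exists z y, [/\ cabs z = r, sqsum y &
    nrm (subI T z y) ^+ 2 < (eps - d) ^+ 2 * nrm y ^+ 2].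
  apply: (fourth_roots_average (pair_op hT) (ltW r0) hx); rewrite xw.
  have {hTw} : nrm (T w) ^+ 2 < (eps + d) ^+ 2 * nrm w ^+ 2.
    by rewrite -exprMn ltr_pXn2r ?nnegrE ?mulr_ge0 ?nrm_ge0.
  have {wK} : nrm w ^+ 2 <= K ^+ 2 * nrm x ^+ 2.
    by rewrite -exprMn ler_pXn2r ?nnegrE ?mulr_ge0 ?nrm_ge0 ?(ltW K0).
  have : 0 <= nrm x ^+ 2 by rewrite sqr_ge0.
  move: (nrm x ^+ 2) (nrm w ^+ 2) (nrm (T w) ^+ 2) => X W V X0 WX VW.
  apply: (@lt_le_trans _ _ ((eps + d) ^+ 2 * W + r ^+ 4 * X)); first by rewrite ltrD2r.
  have k1 : 4 * eps * d * W <= 4 * eps * (r ^+ 2 * eps / 64) * X.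
    have : 4 * eps * (d * W) <= 4 * eps * (d * (K ^+ 2 * X)).
      by rewrite ler_wpM2l ?(mulr_ge0, ltW e0)// ler_wpM2l// ltW.
    have : 4 * eps * (d * (64 * K ^+ 2)) / 64 * X <= 4 * eps * (r ^+ 2 * eps) / 64 * X.
      by rewrite ler_wpM2r// ler_wpM2r ?invr_ge0// ler_wpM2l// mulr_ge0// ltW.
    by lra.
  have k2 : r ^+ 2 <= eps ^+ 2 / 16.
    have : r ^+ 2 <= (eps / 4) ^+ 2.
      by rewrite ler_pXn2r// nnegrE ?divr_ge0// ltW// r0.
    by rewrite expr_div_n (_ : 4 ^+ 2 = 16 :> R)//; ring.
  have k3 : eps ^+ 2 / 4 <= (eps - d) ^+ 2.
    have : (eps / 2) ^+ 2 <= (eps - d) ^+ 2.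
      by rewrite ler_pXn2r ?nnegrE ?(divr_ge0, ltW e0, ltW ed)//; lra.
    by rewrite expr_div_n (_ : 2 ^+ 2 = 4 :> R)//; ring.
  have k4 : (r ^+ 2 * eps ^+ 2 / 16) * X <= r ^+ 2 * ((eps - d) ^+ 2 - r ^+ 2) * X.
    rewrite ler_wpM2r// -mulrA ler_wpM2l ?sqr_ge0//.
    by have := sqr_ge0 eps; lra.
  have -> : (eps + d) ^+ 2 * W + r ^+ 4 * X =
    (eps - d) ^+ 2 * W + r ^+ 4 * X + 4 * eps * d * W by ring.
  have -> : (eps - d) ^+ 2 * (W + r ^+ 2 * X) = (eps - d) ^+ 2 * W + r ^+ 4 * X +
    r ^+ 2 * ((eps - d) ^+ 2 - r ^+ 2) * X by ring.
  by rewrite lerD2l (le_trans k1)// (le_trans _ k4)//; lra.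
exists z; first by rewrite zr ge_min lexx.
by case=> h1 _; move: h1; apply: (sqr_lt_not_bdd_below (ltW ed) hy).
Qed.

(** The form in which normality enters the estimates; it does not mention the adjoint. *)
Definition paranormal T :=
  forall x, sqsum x -> nrm (T x) ^+ 2 <= nrm (T (T x)) * nrm x.

(** For [w = T x] with [|T w| < c |w|], paranormality gives [|w| <= c |x|]: the ratio is controlled
    by [c] and not by the operator norm, so [r = c / 2] yields a factor independent of [K]. *)
Lemma paranormal_lower_norm_decreases K T Ts c : adjoint_pair K T Ts ->
  paranormal T -> 0 < c -> invertible T -> ~ bdd_below2 T Ts c ->
  exists2 z, cabs z <= c & ~ bdd_below2 (subI T z) (subI Ts z^*) (19 / 20 * c).
Proof.
move=> hT pT c0 iT hn.
have /not_bdd_below[w hw hTw] : ~ bdd_below T c.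
  exact: (bdd_below_adjoint_not hT (ltW c0) iT hn).
have [x hx xw] := invertible_surjective iT hw.
have px := pT _ hx; rewrite xw in px.
have r0 : 0 <= c / 2 by rewrite divr_ge0// ltW.
have s0 : 0 <= 19 / 20 * c by rewrite mulr_ge0// ltW.
have [z [y [zr hy hzy]]] : exists z y, [/\ cabs z = c / 2, sqsum y &
    nrm (subI T z y) ^+ 2 < (19 / 20 * c) ^+ 2 * nrm y ^+ 2].
  apply: (fourth_roots_average (pair_op hT) r0 hx); rewrite xw.
  move: (nrm_ge0 x) (nrm_ge0 w) (nrm_ge0 (T w)) px hTw.
  move: (nrm x) (nrm w) (nrm (T w)) => X W V X0 W0 V0 px hTw.
  have W1 : 0 < W.
    rewrite lt_neqAle W0 andbT; apply/eqP => W2.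
    by move: hTw; rewrite -W2 mulr0 ltNge V0.
  have WX : W <= c * X.
    rewrite -(ler_pM2l W1) -expr2 (le_trans px)//.
    by rewrite mulrA [W * c]mulrC ler_wpM2r// ltW.
  have W2 : W ^+ 2 <= c ^+ 2 * X ^+ 2.
    by rewrite -exprMn ler_pXn2r// nnegrE mulr_ge0// ltW.
  have V2 : V ^+ 2 < c ^+ 2 * W ^+ 2.
    by rewrite -exprMn ltr_pXn2r// nnegrE mulr_ge0// ltW.
  have : c ^+ 2 * W ^+ 2 <= c ^+ 2 * (c ^+ 2 * X ^+ 2).
    by rewrite ler_wpM2l// sqr_ge0.
  have -> : (c / 2) ^+ 4 = c ^+ 2 * c ^+ 2 / 16 by field.
  have -> : (c / 2) ^+ 2 = c ^+ 2 / 4 by field.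
  have -> : (19 / 20 * c) ^+ 2 = 361 / 400 * c ^+ 2 by field.
  have : 0 <= c ^+ 2 * W ^+ 2 by rewrite mulr_ge0// sqr_ge0.
  by move: (V ^+ 2) V2 => v V2; lra.
exists z; first by rewrite zr; lra.
by case=> h1 _; move: h1; apply: (sqr_lt_not_bdd_below s0 hy).
Qed.

(** If the disc of radius [40 c] missed the spectrum, the decrease could be iterated in steps of
    length at most [c q^n], with total at most [20 c]. At the limit the operator is invertible,
    although the lower norms along the way tend to 0. *)
Lemma paranormal_spectrum_near K T Ts c : adjoint_pair K T Ts -> 0 < c ->
  (forall z, paranormal (subI T z)) -> ~ bdd_below2 T Ts c ->
  exists2 z, cabs z <= 40 * c & ~ invertible (subI T z).
Proof.
move=> hT c0 pT hn; apply: contrapT => hno.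
have inv z : cabs z <= 40 * c -> invertible (subI T z).
  by move=> hz; apply: contrapT => h; apply: hno; exists z.
pose q : R := 19 / 20.
pose bad n z := ~ bdd_below2 (subI T z) (subI Ts z^*) (c * q ^+ n).
have q0 : 0 < q by rewrite /q; lra.
have hq n : 0 < c * q ^+ n by rewrite mulr_gt0// exprn_gt0.
(* The premises stand under the existential so that a successor can be chosen for every [z]. *)
have step n z : exists z', cabs z <= 40 * c -> bad n z ->
    cabs (z' - z) <= c * q ^+ n /\ bad n.+1 z'.
  have [[h1 h2]|h] := pselect (cabs z <= 40 * c /\ bad n z); last first.
    by exists z => h1 h2; exfalso; exact: h.
  have [v hv hv'] := paranormal_lower_norm_decreases (adjoint_pair_sub z hT)
    (pT z) (hq n) (inv z h1) h2.
  exists (z + v) => _ _; split; first by rewrite addrC addKr.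
  by move: hv'; rewrite !subI_sub -rmorphD /bad exprS mulrCA.
pose Z := fix Z n : R[i] :=
  if n is m.+1 then projT1 (cid (step m (Z m))) else 0.
have ZP n : cabs (Z n) <= 20 * c * (1 - q ^+ n) /\ bad n (Z n).
  elim: n => [|n [ih1 ih2]].
    rewrite expr0 subrr mulr0 cabs0; split => //; rewrite /bad expr0 mulr1.
    by rewrite conjC0 !subI0.
  have Zn : cabs (Z n) <= 40 * c.
    by rewrite (le_trans ih1)//; have := hq n; lra.
  rewrite /=; case: (cid _) => z' /= /(_ Zn ih2)[h1 h2]; split => //.
  have -> : z' = Z n + (z' - Z n) by ring.
  rewrite (le_trans (cabsD _ _))// (le_trans (lerD ih1 h1))// exprS /q.
  by set Q := (19 / 20) ^+ n; lra.
have Zd n : cabs (Z n.+1 - Z n) <= c * q ^+ n.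
  have [ih1 ih2] := ZP n.
  have Zn : cabs (Z n) <= 40 * c.
    by rewrite (le_trans ih1)//; have := hq n; lra.
  by rewrite /=; case: (cid _) => z' /= /(_ Zn ih2)[h1 h2].
have q1 : q < 1 by rewrite /q; lra.
have [z hz] := geometric_cvg (ltW c0) (ltW q0) q1 Zd.
have e : 2 * c / (1 - q) = 40 * c by rewrite /q; field.
have /inv iz : cabs z <= 40 * c.
  by have := hz 0%N; rewrite e expr0 mulr1 /= sub0r cabsN.
have [d d0 hd] := invertible_bdd_below2 (adjoint_pair_sub z hT) iz.
(* [41 = 40 + 1]: the distance from [Z n] to the limit costs [40 c q^n], and a lower bound [c q^n]
   must remain to contradict [bad n (Z n)]. *)
have [n hn'] := geometric_lt (41 * c) (ltW q0) q1 d0.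
apply: (ZP n).2.
have := bdd_below2_sub (Z n - z) (adjoint_pair_sub z hT) hd.
rewrite !subI_sub -rmorphD addrC subrK; apply: bdd_below2_le.
by have := hz n; rewrite e; lra.
Qed.

End LowerNorms.

(** * Localization of the lower norm of a band operator *)

Section Shifts.
Variable R : realType.
Implicit Types x y : int -> R[i].

Lemma bij_subz (k : int) : bijective (fun n : int => n - k).
Proof. by exists (fun n => n + k) => n; rewrite ?subrK ?addrK. Qed.

Lemma bij_addz (k : int) : bijective (fun n : int => n + k).
Proof. by exists (fun n => n - k) => n; rewrite ?subrK ?addrK. Qed.

Lemma sqsum_shift k x : sqsum x -> sqsum (fun n => x (n - k)).
Proof. by rewrite /sqsum (sqn_reindex x (bij_subz k)). Qed.

Lemma nrm_shift k x : nrm (fun n => x (n - k)) = nrm x.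
Proof. by rewrite /nrm (sqn_reindex x (bij_subz k)). Qed.

Lemma rip_sum (J : Type) (r : seq J) (F : J -> int -> R[i]) y :
  (forall j, sqsum (F j)) -> sqsum y ->
  rip (fun n => \sum_(j <- r) F j n) y = \sum_(j <- r) rip (F j) y.
Proof.
move=> hF hy; elim: r => [|j r ih].
  rewrite big_nil (_ : (fun n => _) = fun=> 0); last first.
    by apply/funext => n; rewrite big_nil.
  rewrite /rip (_ : (fun n => 0 - y n) = fun n => - (0 + y n)).
    by rewrite nrmN subrr mul0r.
  by apply/funext => n; rewrite sub0r add0r.
have -> : (fun n => \sum_(i <- j :: r) F i n) =
    fun n => F j n + \sum_(i <- r) F i n by apply/funext => n; rewrite big_cons.
by rewrite big_cons -ih ripDl//; exact: (sqsum_sum _ hF).1.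
Qed.

(** Offsets are arbitrary and may repeat, so the family contains adjoints and allows the term
    [S^gamma M_u] to be added whether or not [gamma] lies within the band. *)
Definition shift_sum (J : finType) (k : J -> int) (a : J -> int -> R[i]) : opZ R :=
  fun x n => \sum_j a j n * x (n - k j).

Section ShiftSum.
Variables (J : finType) (k : J -> int) (a : J -> int -> R[i]) (Bd : R).
Hypotheses (Bd0 : 0 <= Bd) (ha : forall j n, cabs (a j n) <= Bd).

Lemma shift_term j x : sqsum x -> sqsum (fun n => a j n * x (n - k j)) /\
  nrm (fun n => a j n * x (n - k j)) <= Bd * nrm x.
Proof.
move=> hx; rewrite -(nrm_shift (k j) x); apply: sqn_le_scale => //.
  by move=> n; rewrite cabsM ler_wpM2r// cabs_ge0.
exact: sqsum_shift.
Qed.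

Lemma bounded_op_shift_sum : bounded_op (#|J|%:R * Bd) (shift_sum k a).
Proof.
split.
- by rewrite mulr_ge0.
- move=> z x y; apply/funext => n; rewrite /shift_sum mulr_sumr -big_split.
  by apply: eq_bigr => j _ /=; ring.
- move=> x hx.
  have [h1 h2] := sqsum_sum (index_enum J) (fun j => (shift_term j hx).1).
  split => //; rewrite (le_trans h2)//.
  rewrite (le_trans (ler_sum _ (fun j _ => (shift_term j hx).2)))//.
  by rewrite sumr_const -mulrA mulr_natl.
- move=> x s hs n; rewrite /shift_sum (le_trans (cabs_sum _))//.
  rewrite (le_trans (ler_sum _ (_ : forall j, true -> _ <= Bd * s)))//.
    by move=> j _; rewrite cabsM ler_pM// cabs_ge0.
  by rewrite sumr_const -mulrA mulr_natl.
Qed.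

End ShiftSum.

(** Termwise, the adjoint of [M_a S^k] is [S^(-k)] after multiplication by the conjugate of [a],
    whose coefficient at [n] is the conjugate of [a (n + k)]. *)
Lemma adjoint_pair_shift_sum (J : finType) (k : J -> int) (a : J -> int -> R[i])
    (Bd : R) : 0 <= Bd -> (forall j n, cabs (a j n) <= Bd) ->
  adjoint_pair (#|J|%:R * Bd) (shift_sum k a)
    (shift_sum (fun j => - k j) (fun j n => (a j (n + k j))^*)).
Proof.
move=> Bd0 ha.
have ha' j n : cabs (a j (n + k j))^* <= Bd by rewrite cabs_conj.
split; [exact: bounded_op_shift_sum|exact: bounded_op_shift_sum|].
move=> x y hx hy.
have h1 j := (shift_term k Bd0 ha j hx).1.
have h2 j := (shift_term (fun j => - k j) Bd0 ha' j hy).1.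
rewrite [LHS]rip_sum// [RHS]ripC//; last exact: (sqsum_sum _ h2).1.
rewrite [RHS]rip_sum//; apply: eq_bigr => j _.
rewrite [RHS]ripC//.
have hay : sqsum (fun n => (a j n)^* * y n).
  by have [] := @sqn_le_scale _ _ Bd y (fun n => (a j n)^* * y n) Bd0 _ hy;
    rewrite // => n; rewrite cabsM cabs_conj ler_wpM2r// cabs_ge0.
rewrite (ripMl (a := a j) (h1 j) (sqsum_shift (k j) hx))//.
rewrite -(rip_reindex (fun n => x (n - k j)) (fun n => (a j n)^* * y n)
  (bij_addz (k j))).
have -> : (fun n => x (n + k j - k j)) = x by apply/funext => n; rewrite addrK.
have -> // : (fun n => (a j (n + k j))^* * y (n + k j)) =
    fun n => (a j (n + k j))^* * y (n - - k j).
by apply/funext => n; rewrite opprK.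
Qed.

(** * Unit vectors, indicators of intervals and tensor products *)

Definition delta (m : int) : int -> R[i] := fun n => if n == m then 1 else 0.

Lemma sqn_delta m : sqn (delta m) = 1%E.
Proof.
rewrite /sqn; transitivity (\esum_(n in [set m]) (1%:E : \bar R))%E.
  rewrite [RHS]esum_mkcond; apply: eq_esum => n _.
  rewrite /delta; case: eqP => [->|nm].
    by rewrite mem_set// /cabs /= expr1n expr0n addr0 sqrtr1 expr1n.
  by rewrite memNset// cabs0 expr0n.
by rewrite esum_set1// lee_fin.
Qed.

Lemma sqsum_delta m : sqsum (delta m).
Proof. by rewrite /sqsum sqn_delta ltry. Qed.

Lemma nrm_delta m : nrm (delta m) = 1.
Proof. by rewrite /nrm sqn_delta /= sqrtr1. Qed.

Definition box (N : nat) : int -> R[i] := fun n => if 0 <= n < N%:Z then 1 else 0.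

Lemma boxS N : box N.+1 = fun n => box N n + delta N%:Z n.
Proof.
apply/funext => n; rewrite /box /delta.
case: (eqVneq n N%:Z) => [->|nN].
  by rewrite ltxx andbF add0r ltz_nat ltnSn lez_nat.
rewrite addr0; congr (if _ then _ else _); lia.
Qed.

Lemma sqsum_box N : sqsum (box N).
Proof.
elim: N => [|N ih]; last by rewrite boxS; exact: sqsumD ih (sqsum_delta _).
rewrite (_ : box 0 = fun=> 0); first exact: sqsum0.
by apply/funext => n; rewrite /box; case: ifP => //; lia.
Qed.

Lemma nrm_box N : nrm (box N) = Num.sqrt N%:R.
Proof.
suff : nrm (box N) ^+ 2 = N%:R by move=> <-; rewrite sqrtr_sqr ger0_norm// nrm_ge0.
elim: N => [|N ih].
  rewrite (_ : box 0 = fun=> 0) ?nrm0 ?expr0n//.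
  by apply/funext => n; rewrite /box; case: ifP => //; lia.
(* The supports are disjoint, so sum and difference have equal norms and the parallelogram law
   becomes Pythagoras. *)
have := parallelogram (sqsum_box N) (sqsum_delta N%:Z).
rewrite (_ : nrm (fun n => box N n - delta N%:Z n) =
             nrm (fun n => box N n + delta N%:Z n)); last first.
  rewrite /nrm /sqn; congr (Num.sqrt (fine _)); apply: eq_esum => n _.
  congr (_ ^+ 2)%:E; rewrite /box /delta.
  case: (eqVneq n N%:Z) => [->|nN]; last by rewrite subr0 addr0.
  by rewrite ltxx andbF !add0r cabsN.
by rewrite -boxS nrm_delta ih expr1n -natr1; lra.
Qed.

Let box_shift1 N : nrm (fun n => box N (n - 1) - box N n) <= 2.
Proof.
rewrite (_ : (fun n => _) = fun n => delta N%:Z n - delta 0 n).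
  by rewrite (le_trans (nrmB (sqsum_delta _) (sqsum_delta _)))// !nrm_delta.
apply/funext => n; rewrite /box /delta.
case: N => [|N]; first by rewrite subrr; do 2 (case: ifP; first lia); rewrite subr0.
case: (eqVneq n 0) => [->|n0].
  by rewrite /= !sub0r.
case: (eqVneq n N.+1%:Z) => [->|nN].
  by rewrite ltxx andbF !subr0 ifT//; lia.
rewrite [X in X - _](_ : _ = if 0 <= n < N.+1%:Z then 1 else 0) ?subrr//.
congr (if _ then _ else _); lia.
Qed.

(** Telescopes into unit shifts, each changing only the two end points. The bound is free of [N]
    while [box N] has norm [sqrt N], which is the source of the [O(1/sqrt N)] error. *)
Lemma box_shift N (k : int) : nrm (fun n => box N (n - k) - box N n) <= 2 * `|k|%N%:R.
Proof.
have pos (m : nat) : nrm (fun n => box N (n - m%:Z) - box N n) <= 2 * m%:R.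
  elim: m => [|m ih].
    rewrite mulr0 (_ : (fun n => _) = fun=> 0) ?nrm0//.
    by apply/funext => n; rewrite subr0 subrr.
  rewrite (_ : (fun n => _) = fun n => (box N (n - m%:Z - 1) - box N (n - m%:Z)) +
      (box N (n - m%:Z) - box N n)); last first.
    by apply/funext => n; rewrite addrA subrK -addrA -opprD -PoszD addn1.
  have b := sqsum_box N.
  have b1 := sqsum_shift m%:Z (sqsumB (sqsum_shift 1 b) b).
  have b2 := sqsumB (sqsum_shift m%:Z b) b.
  rewrite (le_trans (nrmD b1 b2))//.
  rewrite (nrm_shift m%:Z (fun n => box N (n - 1) - box N n)).
  by rewrite (le_trans (lerD (box_shift1 N) ih))// -natr1; lra.
case: (intP k) => [|m|m]; [exact: (pos 0)|exact: pos|].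
rewrite (_ : absz _ = m.+1); last by lia.
rewrite -(nrm_shift m.+1%:Z) nrm_subC (le_trans _ (pos m.+1))//.
rewrite le_eqVlt; apply/orP; left; apply/eqP; congr nrm; apply/funext => n.
by rewrite opprK subrK.
Qed.

Lemma nrm_tensor (w x : int -> R[i]) : sqsum w -> sqsum x ->
  sqsum (fun p : int * int => w p.1 * x p.2) /\
  nrm (fun p : int * int => w p.1 * x p.2) = nrm w * nrm x.
Proof.
move=> hw hx.
have e : sqn (fun p : int * int => w p.1 * x p.2) = ((nrm w * nrm x) ^+ 2)%:E.
  rewrite /sqn (_ : [set: int * int] = setT `*`` (fun=> setT)); last first.
    by apply/seteqP; split.
  rewrite -(@esum_esum R int int setT (fun=> setT)
    (fun i n => (cabs (w i * x n) ^+ 2)%:E)); last first.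
    by move=> i n _ _; rewrite lee_fin sqr_ge0.
  transitivity (sqn (fun i => (nrm x)%:C%C * w i)).
    apply: eq_esum => i _; rewrite -/(sqn (fun n => w i * x n)).
    rewrite sqnE; last exact: sqsumZ.
    by rewrite nrmZ// cabsM cabsR ger0_norm ?nrm_ge0// mulrC.
  rewrite sqnE; last exact: sqsumZ.
  by rewrite nrmZ// cabsR ger0_norm ?nrm_ge0// mulrC.
split; first by rewrite /sqsum e ltry.
by apply: nrm_sqrE e; rewrite mulr_ge0// nrm_ge0.
Qed.

(** Splits the plane into the diagonals [n - i = j], each of which carries one truncation. *)
Lemma sqn_slices (F : int * int -> R[i]) :
  sqn F = (\esum_(j in [set: int]) sqn (fun n => F ((n - j)%R, n)))%E.
Proof.
have be : bijective (fun p : int * int => (p.2 - p.1, p.2)).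
  by exists (fun p => (p.2 - p.1, p.2)) => -[j n] /=; congr pair; ring.
rewrite -(sqn_reindex F be) /sqn.
rewrite (@esum_esum R int int setT (fun=> setT)
  (fun j n => (cabs (F ((n - j)%R, n)) ^+ 2)%:E)); last first.
  by move=> i n _ _; rewrite lee_fin sqr_ge0.
by congr esum; apply/seteqP; split.
Qed.

(** * Lower bounds on vectors of short support *)

Definition bdd_below_on (N : nat) (T : opZ R) (c : R) :=
  forall (j : int) (y : int -> R[i]), sqsum y ->
    (forall n, ~~ (j <= n < j + N%:Z) -> y n = 0) -> c * nrm y <= nrm (T y).

(* Apply the hypothesis to all truncations [y_j] of [x] to [j, j + N[ at once,
   in the coordinates [(i, n)] with [j = n - i]; there the family [y_j] is the
   tensor product of [box N] and [x], and so is each term of its commutator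
   with [T]. *)
Lemma bdd_below_local (J : finType) (k : J -> int) (a : J -> int -> R[i])
    (Bd : R) (z : R[i]) (N : nat) (c : R) :
  0 <= Bd -> (forall j n, cabs (a j n) <= Bd) -> 0 <= c -> (0 < N)%N ->
  bdd_below_on N (subI (shift_sum k a) z) c ->
  bdd_below (subI (shift_sum k a) z)
    (c - (\sum_j Bd * (2 * `|k j|%N%:R)) / Num.sqrt N%:R).
Proof.
move=> Bd0 ha c0 N0 loc x hx; set T := subI _ z; set D := \sum_j _.
have hT : bounded_op (#|J|%:R * Bd + cabs z) T.
  exact/bounded_op_sub/bounded_op_shift_sum.
have [hTx _] := bounded_l2 hT hx.
have [t1 n1] := nrm_tensor (sqsum_box N) hx.
have [t2 n2] := nrm_tensor (sqsum_box N) hTx.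
(* The commutator of truncation with the [j]-th weighted shift; the scalar [z] commutes and
   contributes nothing. *)
pose G (j : J) (p : int * int) : R[i] :=
  a j p.2 * ((box N (p.1 - k j) - box N p.1) * x (p.2 - k j)).
have hG j : sqsum (G j) /\ nrm (G j) <= Bd * (2 * `|k j|%N%:R) * nrm x.
  have bb := sqsumB (sqsum_shift (k j) (sqsum_box N)) (sqsum_box N).
  have [t n] := nrm_tensor bb (sqsum_shift (k j) hx).
  have [|h1 h2] := @sqn_le_scale _ _ Bd _ (G j) Bd0 _ t.
    by move=> p; rewrite /G [leLHS]cabsM ler_wpM2r// cabs_ge0.
  split => //; rewrite (le_trans h2)// n nrm_shift -mulrA ler_wpM2l//.
  by rewrite ler_wpM2r ?nrm_ge0// box_shift.
have [hG1 hG2] := sqsum_sum (index_enum J) (fun j => (hG j).1).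
pose F (p : int * int) : R[i] :=
  box N p.1 * T x p.2 + \sum_(j <- index_enum J) G j p.
have hF : sqsum F by exact: sqsumD.
have FE (j n : int) : F (n - j, n) = T (fun m => box N (m - j) * x m) n.
  rewrite /F /T /subI /shift_sum /= mulrBr mulr_sumr addrAC -big_split /=.
  congr (_ - _); last by ring.
  apply: eq_bigr => i _; rewrite /G /= (addrAC n); ring.
pose BX (p : int * int) : R[i] := box N p.1 * x p.2.
(* The local bounds, squared, are summed over all diagonals: there [BX] is the truncation of [x] and
   [F] its image under [T]. *)
have key : c * nrm BX <= nrm F.
  rewrite -(ler_pXn2r (n := 2)) ?nnegrE ?mulr_ge0 ?nrm_ge0//.
  rewrite exprMn -lee_fin EFinM -!sqnE// (sqn_slices F).
  rewrite -[c]ger0_norm// -[`|c|]cabsR.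
  have -> : ((cabs c%:C%C ^+ 2)%:E * sqn BX)%E = sqn (fun p => c%:C%C * BX p).
    by rewrite !sqnE//; [rewrite nrmZ// exprMn|exact: sqsumZ].
  rewrite sqn_slices; apply: le_esum => j _.
  have hb : sqsum (fun n => box N (n - j) * x n).
    apply: (@sqn_le_scale _ _ 1 x _ _ _ hx).1 => // n.
    rewrite cabsM ler_wpM2r ?cabs_ge0// /box; case: ifP => _.
      by rewrite -[1]/(1%:C%C) cabsR normr1.
    by rewrite cabs0.
  have [hTb _] := bounded_l2 hT hb.
  have -> : (fun n => F ((n - j)%R, n)) = T (fun m => box N (m - j) * x m).
    by apply/funext => n; exact: FE.
  rewrite !sqnE//; last exact: sqsumZ.
  rewrite nrmZ// lee_fin ler_pXn2r ?nnegrE ?mulr_ge0 ?nrm_ge0 ?cabs_ge0//.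
  rewrite cabsR ger0_norm//; apply: (loc j) => // n hn.
  rewrite /BX /box ifF ?mul0r//; apply/negbTE; apply: contra hn.
  by rewrite subr_ge0 ltrBlDl.
have N1 : 0 < Num.sqrt N%:R :> R by rewrite sqrtr_gt0 ltr0n.
rewrite /BX n1 nrm_box in key; rewrite nrm_box in n2.
have hFn : nrm F <= Num.sqrt N%:R * nrm (T x) + D * nrm x.
  rewrite (le_trans (nrmD t2 hG1))// n2 lerD2l (le_trans hG2)//.
  by rewrite /D mulr_suml; apply: ler_sum => j _; exact: (hG j).2.
rewrite -(ler_pM2l N1) (_ : _ * ((c - _) * _) =
  c * (Num.sqrt N%:R * nrm x) - D * nrm x); last by field; rewrite gt_eqF.
by rewrite lerBlDr (le_trans key).
Qed.

(** On vectors supported in [[j, j + N[], only the letters of [v] at the [N] positions from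
    [m = j + q - p] on matter. The same word occurs in [u] at some [m']; translating by [m' - m]
    identifies the two images, the remaining coefficients being constant. *)
Lemma bdd_below_on_subwords (J : finType) (k : J -> int) (al : J -> R[i])
    (f : R[i] -> R[i]) (p q : int) (u v : int -> R[i]) (z : R[i]) N c :
  let T w := subI (shift_sum (fun j => if j is Some i then k i else q)
    (fun j n => if j is Some i then al i else f (w (n - p)))) z in
  subwords N u = subwords N v -> bdd_below_on N (T u) c -> bdd_below_on N (T v) c.
Proof.
move=> T uv h j y hy supp; pose m := j + q - p.
have [m' _ hm'] : subwords N u (mkseq (fun i => v (m + i%:Z)) N).
  by rewrite uv; exists m.
have {}hm' i : (i < N)%N -> u (m' + i%:Z) = v (m + i%:Z).
  by move=> iN; move/(congr1 (fun s => nth 0 s i)): hm'; rewrite !nth_mkseq.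
pose s := m' - m.
have -> : nrm (T v y) = nrm (T u (fun n => y (n - s))).
  rewrite -(nrm_shift s); congr nrm; apply/funext => n.
  rewrite /T /subI /shift_sum; congr (_ - _); apply: eq_bigr => -[i|] _.
    by rewrite (addrAC n).
  have -> : n - s - q = n - q - s by ring.
  have [/andP[h1 h2]|/supp ->] := boolP (j <= n - q - s < j + N%:Z); last first.
    by rewrite !mulr0.
  congr (f _ * _).
  have := hm' (absz (n - q - s - j)%R); rewrite gez0_abs ?subr_ge0//.
  have -> : m' + (n - q - s - j) = n - p by rewrite /s /m; ring.
  have -> : m + (n - q - s - j) = n - s - p by rewrite /m; ring.
  by move=> ->//; lia.
rewrite -(nrm_shift s y); apply: (h (j + s)); first exact: sqsum_shift.
by move=> n hn; apply: supp; apply: contra hn; lia.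
Qed.

End Shifts.

(** * Convergence of spectral quantities *)

Section Convergence.
Variable R : realType.
Implicit Types (T Ts : opZ R) (x y : int -> R[i]) (K c : R) (z lam : R[i]).

Lemma bounded_op_le K K' T : K <= K' -> bounded_op K T -> bounded_op K' T.
Proof.
move=> KK' h; split.
- by rewrite (le_trans (bounded_ge0 h)).
- exact: bounded_lin h.
- move=> x hx; have [h1 h2] := bounded_l2 h hx; split => //.
  by rewrite (le_trans h2)// ler_wpM2r// nrm_ge0.
- move=> x s hs n; rewrite (le_trans (bounded_sup h hs n))// ler_wpM2r//.
  by rewrite (le_trans _ (hs 0))// cabs_ge0.
Qed.

Lemma adjoint_pair_le K K' T Ts : K <= K' -> adjoint_pair K T Ts ->
  adjoint_pair K' T Ts.
Proof. by move=> KK' [h1 h2 h3]; split => //; exact: bounded_op_le KK' _. Qed.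

Lemma bdd_below_far K T z c : bounded_op K T -> K + c <= cabs z ->
  bdd_below (subI T z) c.
Proof.
move=> hT hz x hx; have [hTx hn] := bounded_l2 hT hx.
rewrite /subI nrm_subC (le_trans _ (nrm_dist (sqsumZ z hx) hTx))// nrmZ//.
have := ler_wpM2r (nrm_ge0 x) hz; rewrite mulrDl; lra.
Qed.

(** Confines [z] to a disc and thereby bounds [subI T z] uniformly, as the uniform constant of
    [lower_norm_decreases] requires. *)
Lemma bdd_below2_near K T Ts z c : adjoint_pair K T Ts ->
  ~ bdd_below2 (subI T z) (subI Ts z^*) c -> cabs z <= K + c.
Proof.
move=> hT h; rewrite leNgt; apply/negP => /ltW hz; apply: h; split.
  exact: (bdd_below_far (pair_op hT)).
by apply: (bdd_below_far (pair_adj hT)); rewrite cabs_conj.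
Qed.

Lemma bdd_below_bounded K T c : bounded_op K T -> bdd_below T c -> c <= K.
Proof.
move=> hT h; have hd := sqsum_delta R 0.
have := le_trans (h _ hd) (bounded_l2 hT hd).2.
by rewrite nrm_delta !mulr1.
Qed.

Lemma pseudospectrumP K T Ts eps lam : adjoint_pair K T Ts -> 0 < eps ->
  pseudospectrum T eps lam <-> ~ bdd_below2 (subI T lam) (subI Ts lam^*) eps.
Proof.
move=> hT e0; rewrite /pseudospectrum /=.
have [h1 h2] := invnorm_le (adjoint_pair_sub lam hT) e0.
rewrite ltNge; split => [/negP h /h2 //|h]; apply/negP => /h1; exact: h.
Qed.

Lemma spectrum_bdd_below2 K T Ts lam c : adjoint_pair K T Ts -> 0 < c ->
  spectrum T lam -> ~ bdd_below2 (subI T lam) (subI Ts lam^*) c.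
Proof.
move=> hT c0 h h'; apply: h.
exact: (bdd_below2_invertible (adjoint_pair_sub lam hT) c0).
Qed.

(** Plays the part of Liouville's theorem. Otherwise let [s] be the supremum of the lower bounds
    valid for all [lam]: some lower norm is below [s + d], so one nearby is below [s - d], a
    contradiction. *)
Lemma pseudospectrum_nonempty K T Ts eps : adjoint_pair K T Ts -> 0 < eps ->
  exists lam, pseudospectrum T eps lam.
Proof.
move=> hT e0; have K0 : 0 <= K := bounded_ge0 (pair_op hT).
apply: contrapT => hno.
pose S := [set c : R | 0 < c /\
  forall lam, bdd_below2 (subI T lam) (subI Ts lam^*) c].
have Se : S eps.
  split => // lam; apply: contrapT => h; apply: hno; exists lam.
  exact/(pseudospectrumP _ hT e0).
have Sub : ubound S K.
  move=> c [_ /(_ 0)]; rewrite conjC0 !subI0 => -[h _].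
  exact: bdd_below_bounded (pair_op hT) h.
have Ssup : has_sup S by split; [exists eps|exists K].
set s := sup S.
have s0 : 0 < s by rewrite (lt_le_trans e0)//; apply: ub_le_sup => //; exists K.
have K'0 : 0 < K + (K + 2 * s) by lra.
have [d /andP[d0 ds] hd] := lower_norm_decreases K'0 s0 ltr01.
have [lam hlam] : exists lam, ~ bdd_below2 (subI T lam) (subI Ts lam^*) (s + d).
  apply: contrapT => h; have : S (s + d).
    split; first by rewrite addr_gt0.
    by move=> lam; apply: contrapT => h'; apply: h; exists lam.
  by move=> /(ub_le_sup Ssup.2); rewrite -/s; lra.
have lb := bdd_below2_near hT hlam.
have hT' : adjoint_pair (K + (K + 2 * s)) (subI T lam) (subI Ts lam^*).
  by apply: adjoint_pair_le (adjoint_pair_sub lam hT); lra.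
have [z _] := hd _ _ hT' hlam; apply.
have [c [_ Sc] hc] := sup_adherent d0 Ssup.
by rewrite !subI_sub -rmorphD; exact: bdd_below2_le (ltW hc) (Sc _).
Qed.

Lemma cvge_near (h : nat -> \bar R) (r : R) :
  (forall e, 0 < e -> \forall m \near \oo, ((r - e)%:E <= h m <= (r + e)%:E)%E) ->
  h m @[m --> \oo] --> r%:E.
Proof.
move=> H; apply/fine_cvgP; split.
  apply: filterS (H 1 ltr01) => m /andP[h1 h2].
  by rewrite fin_numE -ltNye -ltey (lt_le_trans (ltNyr _) h1) (le_lt_trans h2 (ltry _)).
apply/cvgrPdist_le => e e0; apply: filterS (H e e0) => m /=.
case: (h m) => [s| |] /andP[]; rewrite ?lee_fin ?leye_eq ?leeNy_eq//.
by move=> h1 h2; rewrite /= ler_distlC h1 h2.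
Qed.

Lemma hausdorff_le (X Y : set R[i]) (e : R) :
  (forall p, X p -> exists2 q, Y q & cabs (p - q) <= e) ->
  (forall q, Y q -> exists2 p, X p & cabs (q - p) <= e) ->
  (hausdorff X Y <= e%:E)%E.
Proof.
move=> h1 h2; rewrite /hausdorff ge_max; apply/andP; split;
  apply: ge_ereal_sup => _ [p hp <-]; rewrite /cdist.
- have [y Yy hy] := h1 p hp; apply: (@le_trans _ _ (cabs (p - y))%:E).
    by apply: ereal_inf_lbound; exists y.
  by rewrite lee_fin.
- have [x Xx hx] := h2 p hp; apply: (@le_trans _ _ (cabs (p - x))%:E).
    by apply: ereal_inf_lbound; exists x.
  by rewrite lee_fin.
Qed.

Lemma hausdorff_ge0 (X Y : set R[i]) q : Y q -> (0 <= hausdorff X Y)%E.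
Proof.
move=> Yq; rewrite /hausdorff le_max; apply/orP; right.
apply: (@le_trans _ _ (cdist q X)).
  by apply: le_ereal_inf_tmp => _ [x _ <-]; rewrite lee_fin cabs_ge0.
by apply: ereal_sup_ubound; exists q.
Qed.

(** Nonemptiness of [Y] makes the distance nonnegative; between two empty sets [hausdorff] is
    [-oo]. *)
Lemma hausdorff_cvg0 (X : nat -> set R[i]) (Y : set R[i]) :
  Y !=set0 ->
  (forall e, 0 < e -> \forall m \near \oo,
    (forall p, X m p -> exists2 q, Y q & cabs (p - q) <= e) /\
    (forall q, Y q -> exists2 p, X m p & cabs (q - p) <= e)) ->
  hausdorff (X m) Y @[m --> \oo] --> 0%E.
Proof.
move=> [q Yq] H; apply: cvge_near => e e0; apply: filterS (H e e0) => m [h1 h2].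
rewrite sub0r add0r hausdorff_le// andbT (le_trans _ (hausdorff_ge0 _ Yq))//.
by rewrite lee_fin oppr_le0 ltW.
Qed.

(** A point where [T] fails the bound [eps] has a neighbour where [T] fails [eps - delta], and there
    [T'] fails [eps]. The [delta] depends only on [K], [eps] and [eta], so the roles of limit and
    approximant can be exchanged. *)
Lemma pseudospectrum_near K (eps eta : R) : 0 <= K -> 0 < eps -> 0 < eta ->
  exists2 delta, 0 < delta & forall T Ts T' Ts',
    adjoint_pair K T Ts -> adjoint_pair K T' Ts' ->
    (forall z, bdd_below2 (subI T' z) (subI Ts' z^*) eps ->
       bdd_below2 (subI T z) (subI Ts z^*) (eps - delta)) ->
    forall lam, pseudospectrum T eps lam ->
    exists2 mu, pseudospectrum T' eps mu & cabs (lam - mu) <= eta.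
Proof.
move=> K0 e0 eta0; have K'0 : 0 < K + (K + eps) by lra.
have [d /andP[d0 de] hd] := lower_norm_decreases K'0 e0 eta0.
exists d => // T Ts T' Ts' hT hT' close lam /(pseudospectrumP _ hT e0) hlam.
have lb := bdd_below2_near hT hlam.
have hTl : adjoint_pair (K + (K + eps)) (subI T lam) (subI Ts lam^*).
  by apply: adjoint_pair_le (adjoint_pair_sub lam hT); lra.
have [z hz hn] : exists2 z, cabs z <= eta &
    ~ bdd_below2 (subI (subI T lam) z) (subI (subI Ts lam^*) z^*) (eps - d).
  apply: (hd _ _ hTl); apply: contra_not hlam.
  by apply: bdd_below2_le; rewrite lerDl ltW.
exists (lam + z); last by rewrite opprD addNKr cabsN.
apply/(pseudospectrumP _ hT' e0) => /close; move: hn.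
by rewrite !subI_sub -rmorphD.
Qed.

(** The level [eta / 40] makes the radius [40 c] equal to [eta]; the loss [eta / 80] leaves a
    positive lower bound for [T], which a spectral point violates. *)
Lemma spectrum_near K T Ts T' Ts' (eta : R) : 0 < eta ->
  adjoint_pair K T Ts -> adjoint_pair K T' Ts' ->
  (forall z, paranormal (subI T' z)) ->
  (forall z, bdd_below2 (subI T' z) (subI Ts' z^*) (eta / 40) ->
     bdd_below2 (subI T z) (subI Ts z^*) (eta / 40 - eta / 80)) ->
  forall lam, spectrum T lam -> exists2 mu, spectrum T' mu & cabs (lam - mu) <= eta.
Proof.
move=> eta0 hT hT' pT' close lam hlam.
have c0 : 0 < eta / 40 by rewrite divr_gt0.
have [||z hz hn] := paranormal_spectrum_near (adjoint_pair_sub lam hT') c0.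
- by move=> z; rewrite subI_sub.
- move=> /close; apply: (spectrum_bdd_below2 hT) hlam; lra.
exists (lam + z); first by rewrite /spectrum /= -subI_sub.
by rewrite opprD addNKr cabsN (le_trans hz)//; lra.
Qed.

(** No lower norm exceeds [K], so the bound [K + 1] fails and a spectral point lies nearby. *)
Lemma spectrum_nonempty K T Ts : adjoint_pair K T Ts ->
  (forall z, paranormal (subI T z)) -> spectrum T !=set0.
Proof.
move=> hT pT; have K1 : 0 < K + 1 by rewrite ltr_wpDl// (bounded_ge0 (pair_op hT)).
have [|z _ hz] := paranormal_spectrum_near hT K1 pT; last by exists z.
by move=> [/(bdd_below_bounded (pair_op hT))]; lra.
Qed.

(** Adjoints are unique on l^2, so [Ts'] agrees with [Ts], and commutation gives [|Ss v| = |S v|].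
    Then [|S x|^2 = <x, Ss (S x)> <= |x| |S (S x)|]. *)
Lemma normal_op_paranormal K T Ts z : adjoint_pair K T Ts -> normal_op T ->
  paranormal (subI T z).
Proof.
move=> hT [Ts' [l2Ts' adjTs' comm]].
have hK := pair_op hT; have hKs := pair_adj hT.
have adj' x y : sqsum x -> sqsum y -> rip (T x) y = rip x (Ts' y).
  move=> hx hy; have hTx := (bounded_l2 hK hx).1.
  have hTy : sqsum (Ts' y) by apply/l2E/l2Ts'/l2E.
  apply/eqP; rewrite -subr_eq0; apply/eqP.
  have c1 : (rpsum (T x) y - rpsum x (Ts' y)) N @[N --> \oo] -->
      rip (T x) y - rip x (Ts' y).
    exact: cvgB (rpsum_cvg hTx hy) (rpsum_cvg hx hTy).
  suff c2 : (rpsum (T x) y - rpsum x (Ts' y)) N @[N --> \oo] --> (0 : R).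
    exact: cvg_unique c1 c2.
  have := adjTs' x y ((l2E x).2 hx) ((l2E y).2 hy) => /cvgrPdist_lt c3.
  apply/cvgrPdist_lt => e e0; apply: filterS (c3 e e0) => N /=.
  rewrite !sub0r !normrN; apply: le_lt_trans.
  rewrite (le_trans _ (ler_norm _))//.
  rewrite -[(_ - _) N]/(rpsum (T x) y N - rpsum x (Ts' y) N).
  by rewrite -!Re_ipsum -raddfB Re_ge_cabs.
have eqTs y : sqsum y -> Ts' y = Ts y.
  move=> hy; have hTy : sqsum (Ts' y) by apply/l2E/l2Ts'/l2E.
  have hTy' := (bounded_l2 hKs hy).1.
  pose d n := Ts' y n - Ts y n; have hd : sqsum d by exact: sqsumB.
  have e : Ts' y = fun n => d n + Ts y n.
    by apply/funext => n; rewrite /d subrK.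
  have := adj' d y hd hy; rewrite (pair_rip hT)// e ripDr// ripxx// => h.
  have d2 : nrm d ^+ 2 = 0 by lra.
  have d0 : nrm d = 0 by apply/eqP; rewrite -sqrf_eq0 d2.
  by apply/funext => n; rewrite (nrm0_eq n hd d0) add0r.
pose S := subI T z; pose Ss := subI Ts z^*.
have hS : adjoint_pair (K + cabs z) S Ss := adjoint_pair_sub z hT.
have commS v : sqsum v -> S (Ss v) = Ss (S v).
  move=> hv; have hTv := (bounded_l2 hK hv).1.
  have e1 : (fun n => Ts v n - z^* * v n) = fun n => Ts v n + (- z^*) * v n.
    by apply/funext => n; rewrite mulNr.
  have e2 : (fun n => T v n - z * v n) = fun n => T v n + (- z) * v n.
    by apply/funext => n; rewrite mulNr.
  rewrite /S /Ss /subI; apply/funext => n; rewrite e1 e2.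
  rewrite (bounded_lin hK) (bounded_lin hKs).
  rewrite -(eqTs v hv) (comm v ((l2E v).2 hv)) (eqTs _ hTv) (eqTs _ hv); ring.
have nS v : sqsum v -> nrm (Ss v) = nrm (S v).
  move=> hv; have h1 := (bounded_l2 (pair_op hS) hv).1.
  have h2 := (bounded_l2 (pair_adj hS) hv).1.
  apply: (@pexpIrn _ 2); rewrite ?nnegrE ?nrm_ge0//.
  rewrite -!ripxx// -(pair_rip hS)// commS// ripC//; last first.
    exact: (bounded_l2 (pair_adj hS) h1).1.
  by rewrite -(pair_rip hS).
move=> x hx; have h1 := (bounded_l2 (pair_op hS) hx).1.
rewrite -/S -ripxx// (pair_rip hS)// mulrC -(nS _ h1).
by apply: rip_le => //; exact: (bounded_l2 (pair_adj hS) h1).1.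
Qed.

(** * Families whose lower norms converge uniformly in the spectral parameter *)

Section Family.
Variables (K : R) (T Ts : opZ R) (Tm Tms : nat -> opZ R).
Hypothesis hT : adjoint_pair K T Ts.
Hypothesis hTm : forall m, adjoint_pair K (Tm m) (Tms m).
Hypothesis close : forall delta, 0 < delta -> \forall m \near \oo,
  forall z c, 0 <= c ->
    (bdd_below2 (subI T z) (subI Ts z^*) c ->
       bdd_below2 (subI (Tm m) z) (subI (Tms m) z^*) (c - delta)) /\
    (bdd_below2 (subI (Tm m) z) (subI (Tms m) z^*) c ->
       bdd_below2 (subI T z) (subI Ts z^*) (c - delta)).

(** Thresholds [s < s'] for resolvent norms are lower norms [1/s > 1/s']; their gap serves as
    [delta]. *)
Let invnorm_close (s s' : R) lam : 0 < s -> s < s' -> \forall m \near \oo,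
  ((invnorm (subI T lam) <= s%:E)%E -> (invnorm (subI (Tm m) lam) <= s'%:E)%E) /\
  ((invnorm (subI (Tm m) lam) <= s%:E)%E -> (invnorm (subI T lam) <= s'%:E)%E).
Proof.
move=> s0 ss'; have s'0 := lt_trans s0 ss'.
have is0 : 0 < s^-1 by rewrite invr_gt0.
have is'0 : 0 < s'^-1 by rewrite invr_gt0.
have d0 : 0 < s^-1 - s'^-1 by rewrite subr_gt0 ltf_pV2.
apply: filterS (close d0) => m /(_ lam _ (ltW is0)) [h1 h2].
have hl := adjoint_pair_sub lam hT; have hml := adjoint_pair_sub lam (hTm m).
have e : s^-1 - (s^-1 - s'^-1) = s'^-1 by ring.
rewrite e in h1 h2.
have := invnorm_le hl is0; have := invnorm_le hml is'0.
have := invnorm_le hml is0; have := invnorm_le hl is'0; rewrite !invrK.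
move=> [_ a1] [a2 _] [_ a3] [a4 _].
by split => [/a4/h1/a3|/a2/h2/a1].
Qed.

Lemma invnorm_cvg lam :
  invnorm (subI (Tm m) lam) @[m --> \oo] --> invnorm (subI T lam).
Proof.
have hl := adjoint_pair_sub lam hT.
set g := invnorm (subI T lam).
have lower (r : R) : (r%:E < g)%E -> 0 < r -> forall s, s < r ->
    \forall m \near \oo, (s%:E <= invnorm (subI (Tm m) lam))%E.
  (* The maximum with [r / 2] keeps the threshold positive, as passing to reciprocals demands. *)
  move=> rg r0 s sr; pose t := Num.max s (r / 2).
  have t0 : 0 < t by rewrite lt_max divr_gt0// orbT.
  have tr : t < r by rewrite gt_max sr; lra.
  apply: filterS (invnorm_close lam t0 tr) => m [_ h].
  rewrite leNgt; apply/negP => hs; move: rg; rewrite ltNge => /negP; apply.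
  by apply: h; rewrite (le_trans (ltW hs))// lee_fin le_max lexx.
have g0 : (0 < g)%E.
  have M0 : 0 < K + cabs lam + 1.
    by rewrite ltr_wpDl// (bounded_ge0 (pair_op hl)).
  rewrite (@lt_trans _ _ (K + cabs lam + 1)^-1%:E)//.
    by rewrite lte_fin invr_gt0.
  rewrite ltNge; apply/negP => /(invnorm_le hl M0)[/(bdd_below_bounded (pair_op hl))].
  lra.
(* At a finite value lower and upper estimates combine; at [+oo] the lower ones alone give
   divergence. *)
case gE : g => [r| |]; rewrite gE // in g0 lower *.
  rewrite lte_fin in g0; apply: cvge_near => e e0.
  pose t := Num.max (r - e / 2) (r / 2).
  have tr : t < r by rewrite gt_max; apply/andP; split; lra.
  have t0 : 0 < t by rewrite lt_max divr_gt0// orbT.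
  have et : r - e < t by rewrite lt_max; apply/orP; left; lra.
  have re : r < r + e by rewrite ltrDl.
  apply: filterS2 (lower t tr t0 _ et) (invnorm_close lam g0 re) => m h1 [h2 _].
  by rewrite h1 h2// -/g gE.
apply/cvgeyPge => A.
pose B := Num.max A 0 + 1.
have B0 : 0 < B by rewrite /B ltr_wpDl// le_max lexx orbT.
apply: (lower B) => //; first exact: ltry.
by rewrite /B ltr_pwDr// le_max lexx.
Qed.

Lemma pseudospectrum_cvg eps : 0 < eps ->
  hausdorff (pseudospectrum (Tm m) eps) (pseudospectrum T eps) @[m --> \oo] --> 0%E.
Proof.
move=> e0; apply: hausdorff_cvg0; first exact: pseudospectrum_nonempty hT e0.
move=> eta eta0; have K0 := bounded_ge0 (pair_op hT).
have [d d0 hd] := pseudospectrum_near K0 e0 eta0.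
apply: filterS (close d0) => m h.
split.
  by apply: (hd _ _ _ _ (hTm m) hT) => z; apply: (h z _ (ltW e0)).1.
by apply: (hd _ _ _ _ hT (hTm m)) => z; apply: (h z _ (ltW e0)).2.
Qed.

Lemma spectrum_cvg : (forall m, normal_op (Tm m)) -> normal_op T ->
  hausdorff (spectrum (Tm m)) (spectrum T) @[m --> \oo] --> 0%E.
Proof.
move=> nTm nT.
have pT z := normal_op_paranormal z hT nT.
have pTm m z := normal_op_paranormal z (hTm m) (nTm m).
apply: hausdorff_cvg0; first exact: spectrum_nonempty hT pT.
move=> eta eta0; have c0 : 0 <= eta / 40 by rewrite divr_ge0// ltW.
have d0 : 0 < eta / 80 by rewrite divr_gt0.
apply: filterS (close d0) => m h; split.
  by apply: (spectrum_near eta0 (hTm m) hT pT) => z; apply: (h z _ c0).1.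
by apply: (spectrum_near eta0 hT (hTm m) (pTm m)) => z; apply: (h z _ c0).2.
Qed.

End Family.

End Convergence.

(** * Band operators commuting with the shift *)

Section BandOperators.
Variable R : realType.
Implicit Types (u v x : int -> R[i]) (z lam : R[i]).

Lemma big_optionE (V : nmodType) (J : finType) (F : option J -> V) :
  \sum_j F j = F None + \sum_i F (Some i).
Proof.
rewrite (bigD1 None)//=; congr (_ + _).
rewrite (reindex_omap Some id); last by case.
by apply: eq_bigl => j; rewrite eqxx.
Qed.

Lemma shiftZ_delta m : shiftZ (@delta R m) = @delta R (m + 1).
Proof.
apply/funext => n; rewrite /shiftZ /shiftp /delta; congr (if _ then _ else _).
by rewrite subr_eq.
Qed.

Lemma band_delta w (a : int -> int -> R[i]) (i : 'I_w.*2.+1) n :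
  band w a (delta R (n - (i%:Z - w%:Z))) n = a (i%:Z - w%:Z) n.
Proof.
rewrite /band (bigD1 i)//= big1; first by rewrite /delta eqxx mulr1 addr0.
move=> i' i'i; rewrite /delta ifF ?mulr0//; apply/negbTE; apply: contra i'i => /eqP h.
by apply/eqP/val_inj => /=; lia.
Qed.

(** Evaluating both sides on a unit vector isolates a single coefficient and shows that it is the
    same at [n] and [n + 1]. *)
Lemma band_commutes_const w (a : int -> int -> R[i]) :
  (forall x, l2 x -> band w a (shiftZ x) = shiftZ (band w a x)) ->
  forall (i : 'I_w.*2.+1) n, a (i%:Z - w%:Z) n = a (i%:Z - w%:Z) 0.
Proof.
move=> h i; set kappa := _ - _.
have step n : a kappa (n + 1) = a kappa n.
  rewrite -!(band_delta a) -/kappa.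
  have := h _ ((l2E _).2 (sqsum_delta R (n - kappa))).
  move=> /(congr1 (fun f => f (n + 1))); rewrite shiftZ_delta.
  by rewrite /shiftZ /shiftp addrK => <-; rewrite (addrAC n).
have pos (m : nat) n : a kappa (n + m%:Z) = a kappa n.
  elim: m => [|m ih]; first by rewrite addr0.
  by rewrite -addn1 PoszD addrA step.
move=> n; case: (intP n) => [//|m|m]; first by rewrite -[m.+1%:Z]add0r pos.
by rewrite -(pos m.+1 (- m.+1%:Z)) addNr.
Qed.

Variables (w : nat) (al : 'I_w.*2.+1 -> R[i]) (gamma : int).

Let J := option 'I_w.*2.+1.
Let k (i : 'I_w.*2.+1) : int := i%:Z - w%:Z.

(* [p] and [f] cover both [H(u)] ([gamma] and the identity) and its adjoint
   ([0] and complex conjugation). *)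
Definition gen_op (k : 'I_w.*2.+1 -> int) (q : int) (al : 'I_w.*2.+1 -> R[i])
    (f : R[i] -> R[i]) (p : int) u : opZ R :=
  shift_sum (fun j : J => if j is Some i then k i else q)
    (fun (j : J) n => if j is Some i then al i else f (u (n - p))).

Definition Hop_sum u := gen_op k gamma al id gamma u.

Definition Hop_adj u :=
  gen_op (fun i => - k i) (- gamma) (fun i => (al i)^*) (fun y => y^*) 0 u.

Variable Bd : R.
Hypotheses (Bd0 : 0 <= Bd) (hal : forall i, cabs (al i) <= Bd).

Lemma adjoint_pair_Hop u : (forall n, cabs (u n) <= Bd) ->
  adjoint_pair (#|{: J}|%:R * Bd) (Hop_sum u) (Hop_adj u).
Proof.
move=> hu.
have := @adjoint_pair_shift_sum R J (fun j : J => if j is Some i then k i else gamma)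
  (fun (j : J) n => if j is Some i then al i else u (n - gamma)) Bd Bd0.
rewrite (_ : shift_sum (fun j : J => - _) _ = Hop_adj u); first by apply => -[].
apply/funext => x; apply/funext => n; apply: eq_bigr => -[i|] _ //=.
by rewrite addrK subr0.
Qed.

Let D := \sum_(j : J) Bd * (2 * `|if j is Some i then k i else gamma|%N%:R).

Lemma bdd_below2_subwords u v z N c :
  (forall n, cabs (v n) <= Bd) -> subwords N u = subwords N v ->
  (0 < N)%N -> 0 <= c ->
  bdd_below2 (subI (Hop_sum u) z) (subI (Hop_adj u) z^*) c ->
  bdd_below2 (subI (Hop_sum v) z) (subI (Hop_adj v) z^*)
    (c - D / Num.sqrt N%:R).
Proof.
move=> hv uv N0 c0 [h1 h2]; split.
  apply: bdd_below_local => //; first by case.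
  apply: (@bdd_below_on_subwords R _ k al id gamma gamma u v z N c uv).
  by move=> j y hy _; exact: h1.
have -> : D = \sum_(j : J) Bd * (2 * `|if j is Some i then - k i else - gamma|%N%:R).
  by apply: eq_bigr => -[i|] _; rewrite abszN.
apply: bdd_below_local => //.
  by move=> [i|] n; rewrite cabs_conj.
apply: (@bdd_below_on_subwords R _ (fun i => - k i) (fun i => (al i)^*)
  (fun y => y^*) 0 (- gamma) u v z^* N c uv).
by move=> j y hy _; exact: h2.
Qed.

(** [N] is taken so large that the localization error [D / sqrt N] is at most [delta]; it depends on
    neither [z] nor [c], whence the uniformity. The successor in its definition ensures [N > 0]. *)
Lemma bdd_below2_close b (bs : nat -> int -> R[i]) :
  (forall n, cabs (b n) <= Bd) -> (forall m n, cabs (bs m n) <= Bd) ->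
  (forall N : nat, exists m0 : nat, forall m : nat, (m0 <= m)%N ->
     subwords N (bs m) = subwords N b) ->
  forall delta, 0 < delta -> \forall m \near \oo, forall z c, 0 <= c ->
    (bdd_below2 (subI (Hop_sum b) z) (subI (Hop_adj b) z^*) c ->
       bdd_below2 (subI (Hop_sum (bs m)) z) (subI (Hop_adj (bs m)) z^*) (c - delta)) /\
    (bdd_below2 (subI (Hop_sum (bs m)) z) (subI (Hop_adj (bs m)) z^*) c ->
       bdd_below2 (subI (Hop_sum b) z) (subI (Hop_adj b) z^*) (c - delta)).
Proof.
move=> hb hbs hsub delta d0.
pose N := (Num.bound ((D / delta) ^+ 2)).+1.
have D0 : 0 <= D by apply: sumr_ge0 => j _; rewrite !mulr_ge0.
have hN : D / Num.sqrt N%:R <= delta.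
  rewrite ler_pdivrMr ?sqrtr_gt0 ?ltr0n// mulrC -ler_pdivrMr//.
  rewrite -[leLHS]ger0_norm ?divr_ge0 ?(ltW d0)// -sqrtr_sqr ler_sqrt ?ler0n//.
  have := archi_boundP (sqr_ge0 (D / delta)) => /ltW/le_trans; apply.
  by rewrite ler_nat.
have [m0 hm0] := hsub N.
exists m0 => // m /= mm0 z c c0; have e := hm0 m mm0.
have hc : c - delta <= c - D / Num.sqrt N%:R by rewrite lerD2l lerN2.
split => h; apply: bdd_below2_le hc _.
  exact: bdd_below2_subwords (hbs m) (esym e) _ c0 h.
exact: bdd_below2_subwords hb e _ c0 h.
Qed.

End BandOperators.

(** * Boundedness of the alphabet and the convergence theorem *)

Lemma compact_cabs_bounded (R : realType) (Sigma : set R[i]) :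
  compact (Sigma : set (Cnum R)) -> exists2 M : R, 0 <= M &
    forall z, Sigma z -> cabs z <= M.
Proof.
move=> cS.
have cont : continuous (fun z : Cnum R => cabs (z : R[i])).
  move=> z U /nbhs_ballP[e /= e0 hU]; apply/nbhs_ballP.
  exists (e%:C%C : Cnum R); first by rewrite /= ltcR.
  move=> y hy; apply: hU.
  have {}hy : cabs (z - y : R[i]) < e by rewrite -ltcR.
  rewrite /ball /= ltr_norml; apply/andP; split.
    have := cabsD (y - z) (z : R[i]); rewrite subrK cabsB; move: hy; lra.
  by have := cabsD (z - y) (y : R[i]); rewrite subrK; move: hy; lra.
have := continuous_compact (continuous_subspaceT cont) cS.
move=> /(@compact_bounded R R^o)/ex_strict_bound_gt0[M M0 hM].
exists M; first exact: ltW.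
move=> z Sz; have := hM (cabs z) => /= /(_ (ex_intro2 _ _ z Sz erefl)).
by move=> /ltW; rewrite ger0_norm// cabs_ge0.
Qed.

Unset Implicit Arguments.
Set Strict Implicit.
Set Printing Implicit Defensive.

Theorem theorem4p10 (R : realType) (Sigma : set R[i]) (w : nat)
    (a : int -> int -> R[i]) (gamma : int)
    (b : int -> R[i]) (bs : nat -> int -> R[i]) :
  Sigma !=set0 -> compact (Sigma : set (Cnum R)) ->
  (forall k : int, (- (w%:Z) <= k <= w%:Z) ->
     exists M : R, forall n, cabs (a k n) <= M) ->
  (forall x, l2 x -> band w a (shiftZ x) = shiftZ (band w a x)) ->
  (forall n, Sigma (b n)) ->
  (forall m n, Sigma (bs m n)) ->
  (forall N : nat, exists m0 : nat, forall m : nat, (m0 <= m)%N ->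
     subwords N (bs m) = subwords N b) ->
  let L := band w a in
  let A := Hop L gamma b in
  let Am := fun m => Hop L gamma (bs m) in
  [/\ (forall lam : R[i],
         invnorm (subI (Am m) lam) @[m --> \oo] --> invnorm (subI A lam)),
      (forall eps : R, 0 < eps ->
         hausdorff (pseudospectrum (Am m) eps) (pseudospectrum A eps)
           @[m --> \oo] --> 0%E) &
      ((forall m, normal_op (Am m)) -> normal_op A ->
         hausdorff (spectrum (Am m)) (spectrum A) @[m --> \oo] --> 0%E)].
Proof.
move=> _ /compact_cabs_bounded[M M0 hM] _ comm Sb Sbs hsub L A Am.
have const := band_commutes_const comm.
pose al (i : 'I_w.*2.+1) := a (i%:Z - w%:Z) 0.
have HE u : Hop L gamma u = Hop_sum al gamma u.
  apply/funext => x; apply/funext => n.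
  rewrite /Hop_sum /gen_op /shift_sum big_optionE addrC; congr (_ + _).
  by apply: eq_bigr => i _; rewrite const.
(* One bound for the constant diagonals and for all letters, so that [A] and every [Am m] share the
   same operator bound. *)
pose Bd := \sum_i cabs (al i) + M.
have s0 : 0 <= \sum_i cabs (al i) by apply: sumr_ge0 => i _; exact: cabs_ge0.
have Bd0 : 0 <= Bd by rewrite addr_ge0.
have hal i : cabs (al i) <= Bd.
  rewrite /Bd (bigD1 i)//= -addrA lerDl addr_ge0//.
  by apply: sumr_ge0 => j _; exact: cabs_ge0.
have hSig z : Sigma z -> cabs z <= Bd.
  by move=> /hM h; rewrite (le_trans h)// lerDr.
have hb n := hSig _ (Sb n); have hbs m n := hSig _ (Sbs m n).
have hT := adjoint_pair_Hop gamma Bd0 hal hb.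
have hTm m := adjoint_pair_Hop gamma Bd0 hal (hbs m).
have close := bdd_below2_close gamma Bd0 hal hb hbs hsub.
have AmE : Am = fun m => Hop_sum al gamma (bs m).
  by apply/funext => m; exact: HE.
have AE : A = Hop_sum al gamma b by exact: HE.
rewrite AE AmE; split.
- exact: (invnorm_cvg hT hTm close).
- exact: (pseudospectrum_cvg hT hTm close).
- exact: (spectrum_cvg hT hTm close).
Qed.
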